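(* Let $r\le n$, let $\mathbf{a}^1,\dots,\mathbf{a}^r$ be linearly independent vectors in $\mathbb{R}^n$, let $X\subset\mathbb{R}^n$ be a measurable set of finite positive Lebesgue measure, and let $f\in L_2(X)$. Let $Y=J(X)$ be an $r$-set. Put $$g_1^0(y_1)=\frac1{|Y^{(1)}|}f_1^*(y_1)-(r-1)\frac{A}{|Y|},\qquad g_j^0(y_j)=\frac1{|Y^{(j)}|}f_j^*(y_j),\quad j=2,\dots,r.$$ Then the function $\sum_{i=1}^rg_i^0(\mathbf{a}^i\cdot\mathbf{x})$ is the best approximation to $f$ in $L_2(X)$ from $\mathcal{R}(\mathbf{a}^1,\dots,\mathbf{a}^r)$, i.e. it belongs to this set and attains $\inf_{g\in\mathcal{R}(\mathbf{a}^1,\dots,\mathbf{a}^r)}\|f-g\|_{L_2(X)}$.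
   Context: $\mathcal{R}(\mathbf{a}^1,\dots,\mathbf{a}^r)$ is the set of all sums $\sum_{i=1}^rg_i(\mathbf{a}^i\cdot\mathbf{x})$ with $g_i:\mathbb{R}\to\mathbb{R}$ such that each $g_i(\mathbf{a}^i\cdot\mathbf{x})\in L_2(X)$. Complete $\mathbf{a}^1,\dots,\mathbf{a}^r$ to a basis $\mathbf{a}^1,\dots,\mathbf{a}^n$ of $\mathbb{R}^n$, and let $J$ be the linear map $\mathbf{x}\mapsto\mathbf{y}$, $y_i=\mathbf{a}^i\cdot\mathbf{x}$, $i=1,\dots,n$. Put $Y=J(X)$, $Y_i=\{\mathbf{a}^i\cdot\mathbf{x}:\mathbf{x}\in X\}\subset\mathbb{R}$, and $f^*(\mathbf{y})=f(J^{-1}\mathbf{y})$ for $\mathbf{y}\in Y$. The set $Y$ is called an $r$-set if $Y=Y_1\times\dots\times Y_r\times Y_0$ for some set $Y_0\subset\mathbb{R}^{n-r}$ (if $r=n$ the factor $Y_0$ is absent). For $i=1,\dots,r$, $Y^{(i)}$ denotes the Cartesian product of the sets $Y_1,\dots,Y_r,Y_0$ with $Y_i$ omitted, and $d\mathbf{y}^{(i)}$ denotes integration over $Y^{(i)}$, i.e. over all coordinates of $\mathbf y$ except $y_i$. $|\cdot|$ denotes Lebesgue measure (in the appropriate dimension), and $$A=\int_Yf^*(\mathbf{y})\,d\mathbf{y},\qquad f_i^*(y_i)=\int_{Y^{(i)}}f^*(\mathbf{y})\,d\mathbf{y}^{(i)},\quad i=1,\dots,r.$$ *)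

(* Defs.v *)
From HB Require Import structures.
From mathcomp Require Import all_boot all_order all_algebra.
From mathcomp Require Import all_classical all_reals all_analysis.

Set Implicit Arguments.
Unset Strict Implicit.
Unset Printing Implicit Defensive.
Import Order.TTheory GRing.Theory Num.Theory.
Import numFieldNormedType.Exports.
Local Open Scope classical_set_scope.
Local Open Scope ring_scope.

(* Points of R^n are n-tuples; the library equips them with the sigma-algebra
   generated by the coordinates, i.e. the Borel sets. [lebesgueB n] is the
   n-fold product of the Lebesgue measure of R; on R^0 it is the unit mass. *)
Fixpoint lebesgueB {R : realType} (n : nat) :
    set (n.-tuple (measurableTypeR R)) -> \bar R :=
  match n with
  | 0 => fun A => \d_([tuple] : 0.-tuple (measurableTypeR R)) A
  | m.+1 => fun A =>
      (lebesgue_measure \x @lebesgueB R m)%E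
        [set p : measurableTypeR R * m.-tuple (measurableTypeR R)
           | A [the m.+1.-tuple _ of p.1 :: p.2]]
  end.

Section lebesgueB_measure.
Variable R : realType.
Local Notation T := (measurableTypeR R).

Let cons_ n (p : T * n.-tuple T) : n.+1.-tuple T :=
  [the n.+1.-tuple _ of p.1 :: p.2].
Let uncons_ n (y : n.+1.-tuple T) : T * n.-tuple T :=
  (tnth y ord0, [tuple of behead y]).

Let consK n : cancel (@cons_ n) (@uncons_ n).
Proof. by case=> x t; congr pair; exact/val_inj. Qed.

Let measurable_cons_ n : measurable_fun setT (@cons_ n).
Proof. exact: measurable_cons. Qed.

Let measurable_uncons_ n : measurable_fun setT (@uncons_ n).
Proof.
by apply/measurable_fun_pairP; split;
  [exact: measurable_tnth|exact: measurable_behead].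
Qed.

Section step.
Variables (n : nat) (mu : {sigma_finite_measure set (n.-tuple T) -> \bar R}).

Let nu : set (n.+1.-tuple T) -> \bar R :=
  pushforward (lebesgue_measure \x mu)%E (@cons_ n).

Let nu_measure : {measure set (n.+1.-tuple T) -> \bar R} :=
  measure_function_pushforward__canonical__measure_function_Measure
    (lebesgue_measure \x mu)%E (@measurable_cons_ n).

Let nu_sigma_finite : sigma_finite setT nu.
Proof.
have /sigma_finiteP[F [TF ndF Foo]] := sigma_finiteT (@lebesgue_measure R).
have /sigma_finiteP[G [TG ndG Goo]] := sigma_finiteT mu.
exists (fun k => @uncons_ n @^-1` (F k `*` G k)).
  apply/esym; rewrite -subTset => y _.
  have [i _ Fi] : (\bigcup_k F k) (@uncons_ n y).1 by rewrite -TF.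
  have [j _ Gj] : (\bigcup_k G k) (@uncons_ n y).2 by rewrite -TG.
  exists (maxn i j) => //; split.
  - by move: Fi; exact/subsetPset/ndF/leq_maxl.
  - by move: Gj; exact/subsetPset/ndG/leq_maxr.
move=> k; have [mF Fkoo] := Foo k; have [mG Gkoo] := Goo k; split.
  rewrite -[X in measurable X]setTI; apply: measurable_uncons_ => //.
  exact: measurableX.
rewrite /nu /pushforward -comp_preimage (_ : _ \o _ = id); last first.
  by apply/funext => p /=; rewrite consK.
by rewrite preimage_id product_measure1E// lte_mul_pinfty// ge0_fin_numE.
Qed.

HB.instance Definition _ := Measure.copy nu nu_measure.
HB.instance Definition _ := Measure_isSigmaFinite.Build _ _ _ nu nu_sigma_finite.

Lemma lebesgueB_step :
  exists mu' : {sigma_finite_measure set (n.+1.-tuple T) -> \bar R},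
    (mu' : set _ -> \bar R) = fun A => (lebesgue_measure \x mu)%E
      [set p : T * n.-tuple T | A [the n.+1.-tuple _ of p.1 :: p.2]].
Proof. by exists nu. Qed.

End step.

Lemma lebesgueB_sigma_finite_measure n :
  exists mu : {sigma_finite_measure set (n.-tuple T) -> \bar R},
    (mu : set _ -> \bar R) = @lebesgueB R n.
Proof.
elim: n => [|n [mu IH]]; first by exists (\d_([tuple] : 0.-tuple T)).
have [mu' mu'E] := lebesgueB_step mu.
by exists mu'; rewrite mu'E /= IH.
Qed.

Let lebesgueB0 n : @lebesgueB R n set0 = 0%E.
Proof.
by have [mu <-] := lebesgueB_sigma_finite_measure n; rewrite measure0.
Qed.

Let lebesgueB_ge0 n A : (0 <= @lebesgueB R n A)%E.
Proof.
by have [mu <-] := lebesgueB_sigma_finite_measure n; exact: measure_ge0.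
Qed.

Let lebesgueB_sigma_additive n : semi_sigma_additive (@lebesgueB R n).
Proof.
have [mu <-] := lebesgueB_sigma_finite_measure n.
exact: measure_semi_sigma_additive.
Qed.

Let lebesgueB_sigma_finite n : sigma_finite setT (@lebesgueB R n).
Proof.
by have [mu <-] := lebesgueB_sigma_finite_measure n; exact: sigma_finiteT.
Qed.

HB.instance Definition _ n := isMeasure.Build _ _ _ (@lebesgueB R n)
  (lebesgueB0 n) (@lebesgueB_ge0 n) (@lebesgueB_sigma_additive n).
HB.instance Definition _ n := Measure_isSigmaFinite.Build _ _ _
  (@lebesgueB R n) (lebesgueB_sigma_finite n).

End lebesgueB_measure.

(* R^n with its Lebesgue-measurable sets (the completion of the Borel sets) and
   the complete n-dimensional Lebesgue measure. *)
Definition Rn (R : realType) (n : nat) :=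
  caratheodory_type (mu_ext (@lebesgueB R n)).
HB.instance Definition _ R n := Measurable.on (Rn R n).

Definition lebesgue {R : realType} (n : nat) : set (Rn R n) -> \bar R :=
  @completed_measure_extension _ _ _ (@lebesgueB R n).
HB.instance Definition _ R n := Measure.on (@lebesgue R n).
HB.instance Definition _ R n := Measure_isSigmaFinite.Build _ _ _ (@lebesgue R n)
  (completed_measure_extension_sigma_finite (sigma_finiteT (@lebesgueB R n))).

Section L2.
Context {R : realType} {n : nat}.
Implicit Types (X : set (Rn R n)) (f : Rn R n -> R).

(* L_2(X) for real functions on X, extended by 0 outside X. *)
Definition in_L2 X f := (f \_ X) \in Lfun (@lebesgue R n) 2%:E.

Definition L2norm X f : \bar R := 'N[@lebesgue R n]_2%:E[EFin \o (f \_ X)].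

End L2.

Section ridge.
Context {R : realType} {n : nat}.

Definition dot (a : 'rV[R]_n) (x : Rn R n) : R := \sum_(j < n) a 0 j * tnth x j.

(* The rows of A are the directions; the functions are considered on X only. *)
Definition ridge_space r (X : set (Rn R n)) (A : 'M[R]_(r, n)) :
    set (Rn R n -> R) :=
  [set h | exists g : 'I_r -> R -> R,
     (forall i, in_L2 X (fun x => g i (dot (row i A) x))) /\
     h = fun x => \sum_(i < r) g i (dot (row i A) x)].

(* J for the basis given by the rows of B: (J x)_i = b^i . x, so that J^-1 is
   the map J of the inverse matrix. *)
Definition Jmap (B : 'M[R]_n) (x : Rn R n) : Rn R n :=
  [tuple dot (row i B) x | i < n].

Definition Jinv (B : 'M[R]_n) : Rn R n -> Rn R n := Jmap (invmx B).

(* The point of R^n with i-th coordinate t and the others given, in order,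
   by z. *)
Definition insert_coord (i : 'I_n) (t : R) (z : Rn R n.-1) : Rn R n :=
  [tuple if unlift i j is Some k then tnth z k else t | j < n].

End ridge.

Section rset.
Context {R : realType} {n r : nat} (hrn : (r <= n)%N).
Variables (Ys : 'I_r -> set R) (Y0 : set (Rn R (n - r))).

(* Y_1 x ... x Y_r x Y_0 *)
Definition rset : set (Rn R n) :=
  [set y | (forall i, Ys i (tnth y (widen_ord hrn i))) /\ Y0 (drop_tuple r y)].

(* The same product with the factor Y_i omitted; the value 0 given to the
   missing coordinate is not tested. *)
Definition rset_omit (i : 'I_r) : set (Rn R n.-1) :=
  [set z | let y := insert_coord (widen_ord hrn i) 0 z in
     (forall j, j != i -> Ys j (tnth y (widen_ord hrn j))) /\
     Y0 (drop_tuple r y)].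

End rset.

Section best.
Context {R : realType} {n r : nat} (hrn : (r <= n)%N).
Variables (X : set (Rn R n)) (B : 'M[R]_n) (Y0 : set (Rn R (n - r))).
Variable f : Rn R n -> R.

(* Only used on sets of finite measure. *)
Definition vol m (E : set (Rn R m)) : R := fine (lebesgue E).

Definition Yimg : set (Rn R n) := Jmap B @` X.

Definition Yproj (i : 'I_r) : set R := dot (row (widen_ord hrn i) B) @` X.

Definition Yomit (i : 'I_r) : set (Rn R n.-1) := rset_omit hrn Yproj Y0 i.

(* The values of f outside X play no role: f* is only integrated over Y. *)
Definition fstar : Rn R n -> R := f \o Jinv B.

Definition Aint : R := \int[@lebesgue R n]_(y in Yimg) fstar y.

Definition fistar (i : 'I_r) (t : R) : R :=
  \int[@lebesgue R n.-1]_(z in Yomit i)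
     fstar (insert_coord (widen_ord hrn i) t z).

(* The index 0 of 'I_r is the index 1 of g_1^0. *)
Definition g0 (i : 'I_r) (t : R) : R :=
  if i == 0%N :> nat
  then (vol (Yomit i))^-1 * fistar i t - (r%:R - 1) * (Aint / vol Yimg)
  else (vol (Yomit i))^-1 * fistar i t.

End best.

(* Main.v *)
(** Up to a constant factor, Lebesgue measure on X disintegrates over each
    coordinate y_i = a^i . x (a linear change of variables scales Lebesgue
    measure by uniqueness of Haar measure, and Fubini applies). As Y is an
    r-set, all slices of X are the same set Y^(i), so
    p_i = |Y^(i)|^-1 f_i^* (a^i . x) is the mean of f over slices; hence f - p_i
    is orthogonal in L_2(X) to every function of a^i . x. For j <> i,
    p_j - A/|Y| has mean zero and does not depend on y_i, so it is orthogonal to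
    these functions too. Since
    f - h = (f - p_i) - sum_(j <> i) (p_j - A/|Y|) for every i, the residual
    f - h is orthogonal to the whole ridge space. *)

Require Import Defs.
From HB Require Import structures.
From mathcomp Require Import all_boot all_order all_algebra.
From mathcomp Require Import all_classical all_reals all_analysis.
From mathcomp Require Import measurable_realfun ring.

Set Implicit Arguments.
Unset Strict Implicit.
Unset Printing Implicit Defensive.
Import Order.TTheory GRing.Theory Num.Theory.
Import numFieldNormedType.Exports.
Local Open Scope classical_set_scope.
Local Open Scope ring_scope.

(** The measure on R^n is complete, whereas the uniqueness of Haar measure and Tonelli's theorem are
    applied to Borel sets. A measurable function is therefore replaced by a Borel function off a
    Borel null set, and sections of that null set are null only for almost every t: statements about
    slices hold for almost all t. The means p_i, by contrast, are given by a formula at every t, so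
    their measurability and square-integrability have to be proved; the former rests on
    completeness, the latter on Jensen's inequality along slices.

    The factor of the change of variables is never computed. Orthogonality only asks that an
    integral vanish, which can be read off the slices, and the factor cancels in A/|Y|.

    Neither Y_i nor Y^(i) is known to be measurable beforehand. Almost every slice of X is
    measurable and Y_i cannot be null, so some slice over a point of Y_i is measurable, and that
    slice is Y^(i). The set Y_i itself enters only through the pointwise factorisation of the
    indicator of X along slices; no integral over Y_i is formed. *)

(** * Borel representatives for a completed measure *)

Section completion.
Context d (T : measurableType d) (R : realType).
Variable mu : {sigma_finite_measure set T -> \bar R}.
Local Open Scope ereal_scope.
Local Notation C := (caratheodory_type (mu_ext mu)).
Local Notation nu := (@completed_measure_extension _ _ _ mu).

Lemma completed_measureE (A : set T) :
  measurable A -> nu A = mu A.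
Proof. exact: measurable_mu_extE. Qed.

Lemma measurable_completed (A : set T) :
  measurable A -> measurable (A : set C).
Proof. exact: caratheodory_measurable_mu_ext. Qed.

Lemma measure_bigcup0 (N : (set T)^nat) : (forall k, measurable (N k)) ->
  (forall k, mu (N k) = 0) -> mu (\bigcup_k N k) = 0.
Proof.
move=> mN N0; apply/eqP; rewrite eq_le measure_ge0 andbT.
apply: (@le_trans _ _ (\sum_(0 <= k <oo) mu (N k))).
  by apply: measure_sigma_subadditive => //; exact: bigcupT_measurable.
by rewrite eseries0.
Qed.

(** Covers within 1/(k+1) of the outer measure, intersected over k, give a Borel hull of the same
    measure. *)
Lemma borel_outer_cover (A : set T) : nu A < +oo ->
  exists B : set T, [/\ measurable B, A `<=` B & mu B = nu A].
Proof.
move=> Aoo.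
have Afin : nu A \is a fin_num by rewrite ge0_fin_numE// mu_ext_ge0.
have H (k : nat) : exists B : set T,
    [/\ measurable B, A `<=` B & mu B <= nu A + (k.+1%:R^-1)%:E].
  have [|_ [F [mF AF] <-] ltF] :=
    lb_ereal_inf_adherent (e := k.+1%:R^-1%R) _ Afin; first by rewrite invr_gt0.
  exists (\bigcup_m F m); split => //; first exact: bigcupT_measurable.
  apply: le_trans (ltW ltF).
  by apply: measure_sigma_subadditive => //; exact: bigcupT_measurable.
pose B k := proj1_sig (cid (H k)).
have [mB AB leB] : [/\ (forall k, measurable (B k)), (forall k, A `<=` B k)
    & forall k, mu (B k) <= nu A + (k.+1%:R^-1)%:E].
  by split=> k; have [] := proj2_sig (cid (H k)).
have mbig : measurable (\bigcap_k B k) by exact: bigcapT_measurable.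
have Abig : A `<=` \bigcap_k B k by move=> x Ax k _; exact: AB.
exists (\bigcap_k B k); split => //.
apply/eqP; rewrite eq_le; apply/andP; split; last first.
  by rewrite -completed_measureE//; exact: le_mu_ext.
apply/lee_addgt0Pr => /= _/posnumP[e]; near \oo => k.
apply: (@le_trans _ _ (mu (B k))).
  by apply: le_measure; rewrite ?inE//; exact: bigcap_inf.
rewrite (le_trans (leB k))// leeD// lee_fin ltW//.
by near: k; apply: near_infty_natSinv_lt.
Unshelve. all: by end_near. Qed.

Lemma completed_negligible (A : set T) : nu A = 0 ->
  exists B : set T, [/\ measurable B, A `<=` B & mu B = 0].
Proof.
by move=> A0; have [|B [mB AB]] := borel_outer_cover (A := A);
  rewrite A0 ?ltry//; exists B.
Qed.

(** On each piece [F k] of finite measure a Borel hull exceeds the set by a null set, which has a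
    Borel null hull in turn; finiteness is what allows the subtraction. The pieces are then
    glued. *)
Lemma completed_measurable_borel (A : set C) : measurable A ->
  exists B N : set T, [/\ measurable B, measurable N, mu N = 0
    & forall x, ~ N x -> A x <-> B x].
Proof.
move=> mA.
have [F FT Ffin] := sigma_finiteT mu.
have mF k : measurable (F k) by case: (Ffin k).
have H (k : nat) : exists BN : set T * set T, [/\ measurable BN.1,
    measurable BN.2, mu BN.2 = 0
    & forall x, F k x -> ~ BN.2 x -> A x <-> BN.1 x].
  have mAF : measurable (A `&` F k : set C).
    by apply: measurableI => //; exact: measurable_completed.
  have AFoo : nu (A `&` F k) < +oo.
    apply: (@le_lt_trans _ _ (mu (F k))); last by case: (Ffin k).
    rewrite -(completed_measureE (mF k)).
    exact: le_mu_ext.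
  have [B [mB AB muB]] := borel_outer_cover AFoo.
  have : nu (B `\` (A `&` F k)) = 0.
    have nuB : nu B = nu (A `&` F k) by rewrite completed_measureE.
    have -> : nu (B `\` (A `&` F k)) = nu B - nu (B `&` (A `&` F k)).
      apply: measureD => //; first exact: measurable_completed.
      by move: AFoo; rewrite -nuB.
    rewrite setIidr// nuB subee// ge0_fin_numE//.
  move=> /completed_negligible[N [mN BN muN]].
  exists (B, N); split => //= x Fx Nx; split=> [Ax|Bx]; first exact: AB.
  by apply: contrapT => Ax; apply: Nx; apply: BN; split => // -[].
pose B k := (proj1_sig (cid (H k))).1.
pose N k := (proj1_sig (cid (H k))).2.
have HBN k : [/\ measurable (B k), measurable (N k), mu (N k) = 0
    & forall x, F k x -> ~ N k x -> A x <-> B k x].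
  by rewrite /B /N; case: cid.
exists (\bigcup_k (B k `&` F k)), (\bigcup_k N k); split.
- by apply: bigcupT_measurable => k; apply: measurableI => //; case: (HBN k).
- by apply: bigcupT_measurable => k; case: (HBN k).
- by apply: measure_bigcup0 => k; case: (HBN k).
- move=> x Nx; have Nkx k : ~ N k x by move=> ?; apply: Nx; exists k.
  split=> [Ax|[k _ [Bx Fx]]]; last first.
    by case: (HBN k) => _ _ _ /(_ x Fx (Nkx k))[_]; apply.
  have [k _ Fx] : (\bigcup_k F k) x by rewrite -FT.
  exists k => //; split => //.
  by case: (HBN k) => _ _ _ /(_ x Fx (Nkx k))[]; auto.
Qed.

Lemma measurable_fun_completed d' (T' : measurableType d') (f : T -> T') :
  measurable_fun setT f -> measurable_fun (setT : set C) (f : C -> T').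
Proof.
move=> mf _ B mB; rewrite setTI; apply: measurable_completed.
by rewrite -[X in measurable X]setTI; exact: mf.
Qed.

Lemma completed_measurable_fun_borel (f : C -> R) : measurable_fun setT f ->
  exists (g : T -> R) (N : set T), [/\ measurable_fun setT g, measurable N,
    mu N = 0 & forall x, ~ N x -> f x = g x].
Proof.
move=> mf.
have H (q : rat) : exists BN : set T * set T, [/\ measurable BN.1,
    measurable BN.2, mu BN.2 = 0
    & forall x, ~ BN.2 x -> (ratr q < f x)%R <-> BN.1 x].
  have /completed_measurable_borel[B [N [mB mN muN BN]]] :
      measurable (f @^-1` `]ratr q, +oo[%classic : set C).
    by rewrite -[X in measurable X]setTI; exact: mf.
  exists (B, N); split => //= x /BN <-.
  by rewrite /= in_itv/= andbT.
(* Enumerates the rationals; a code of no rational falls back to 0, which only repeats a set. *)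
pose Q k : rat := odflt 0%R (unpickle k).
pose B k := (proj1_sig (cid (H (Q k)))).1.
pose N k := (proj1_sig (cid (H (Q k)))).2.
have HBN k : [/\ measurable (B k), measurable (N k), mu (N k) = 0
    & forall x, ~ N k x -> (ratr (Q k) < f x)%R <-> B k x].
  by rewrite /B /N; case: cid.
have mN : measurable (\bigcup_q N q).
  by apply: bigcupT_measurable => q; case: (HBN q).
exists (f \_ (~` \bigcup_q N q)), (\bigcup_q N q); split => //.
- apply/(measurable_restrictT _ (measurableC mN)).
  apply: (measurability _ (RGenOInfty.measurableE R)).
  move=> _ [_ [x ->] <-].
  (* For real x, f t > x holds exactly when f t > q for some rational q >= x, so the Borel sets at
     rational thresholds settle all thresholds. *)
  rewrite (_ : _ `&` _ = ~` (\bigcup_q N q) `&`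
      \bigcup_q (if (x <= ratr (Q q))%R then B q else set0)).
    apply: measurableI; first exact: measurableC.
    apply: bigcupT_measurable => q; case: ifPn => // _.
    by case: (HBN q).
  apply/seteqP; split=> t [Nt /= H1]; split => //.
  + move: H1; rewrite in_itv/= andbT => xft.
    have [q] := rat_in_itvoo xft; rewrite in_itv/= => /andP[xq qf].
    have Qq : Q (pickle q) = q by rewrite /Q pickleK.
    exists (pickle q) => //; rewrite Qq (ltW xq).
    case: (HBN (pickle q)) => _ _ _ /(_ t) []//.
    + by move=> Nqt; apply: Nt; exists (pickle q).
    + by rewrite Qq => + _; apply.
  + case: H1 => q _; case: ifPn => // xq Bqt.
    rewrite in_itv/= andbT (le_lt_trans xq)//.
    case: (HBN q) => _ _ _ /(_ t) []//; last by auto.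
    by move=> Nqt; apply: Nt; exists q.
- by apply: measure_bigcup0 => k; case: (HBN k).
- by move=> x Nx; rewrite /patch in_setC memNset.
Qed.

Lemma completed_ae_eq (f : C -> \bar R) (g : T -> \bar R) (N : set T) :
  measurable N -> mu N = 0 -> (forall x, ~ N x -> f x = g x) ->
  ae_eq nu setT (g : C -> _) f.
Proof.
move=> mN N0 fg; exists N; split.
- exact: measurable_completed.
- exact: etrans (completed_measureE mN) N0.
- by move=> x /= H; apply: contrapT => Nx; apply: H => _; rewrite fg.
Qed.

Lemma completed_ae_measurable (f : C -> \bar R) (g : T -> \bar R) (N : set T) :
  measurable_fun setT g -> measurable N -> mu N = 0 ->
  (forall x, ~ N x -> f x = g x) -> measurable_fun setT f.
Proof.
move=> mg mN N0 fg.
apply: (ae_measurable_fun _ (completed_ae_eq mN N0 fg)).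
- exact: measure_is_complete_caratheodory.
- exact: measurable_fun_completed.
Qed.

Lemma ge0_integral_completed (f : C -> \bar R) (g : T -> \bar R) (N : set T) :
  measurable_fun setT g -> measurable N -> mu N = 0 ->
  (forall x, ~ N x -> f x = g x) ->
  (forall x, 0 <= f x) -> (forall x, 0 <= g x) ->
  \int[nu]_x f x = \int[mu]_x g x.
Proof.
move=> mg mN N0 fg f0 g0.
have mgC : measurable_fun (setT : set C) (g : C -> \bar R).
  exact: measurable_fun_completed.
have mf : measurable_fun setT f by exact: (completed_ae_measurable mg mN N0 fg).
rewrite (ge0_ae_eq_integral _ mf mgC) //; last first.
  exact/ae_eq_sym/(completed_ae_eq mN N0 fg).
(* The identity from the completed space to the Borel space pushes the completed measure forward to
   [mu]. *)
have mid : measurable_fun (setT : set C) (id : C -> T).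
  by move=> _ A mA; rewrite setTI preimage_id; exact: measurable_completed.
have /= <- := @ge0_integral_pushforward _ _ C T R _ mid nu setT g measurableT mg
  (fun y _ => g0 y).
pose nuid : {measure set T -> \bar R} :=
  measure_function_pushforward__canonical__measure_function_Measure nu mid.
by apply: (@eq_measure_integral _ T R setT mu nuid) => A mA _;
  exact: completed_measureE.
Qed.

End completion.

(** * Integrals along maps that scale a measure *)

Lemma ge0_integral_comp_scale d1 d2 (T1 : measurableType d1)
    (T2 : measurableType d2) (R : realType) (phi : T1 -> T2)
    (m1 : {measure set T1 -> \bar R}) (m2 : {measure set T2 -> \bar R})
    (c : R) (f : T2 -> \bar R) :
  measurable_fun setT phi -> 0 <= c ->
  (forall A, measurable A -> m1 (phi @^-1` A) = (c%:E * m2 A)%E) ->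
  measurable_fun setT f -> (forall y, 0 <= f y)%E ->
  (\int[m1]_x f (phi x) = c%:E * \int[m2]_y f y)%E.
Proof.
move=> mphi c0 m12 mf f0.
have /= <- := @ge0_integral_pushforward _ _ T1 T2 R _ mphi m1 setT f measurableT
  mf (fun y _ => f0 y).
pose nu : {measure set T2 -> \bar R} :=
  measure_function_pushforward__canonical__measure_function_Measure m1 mphi.
rewrite -(ge0_integral_mscale m2 measurableT (NngNum c0))//.
by apply: (@eq_measure_integral _ T2 R setT (mscale (NngNum c0) m2) nu)
  => A mA _; exact: m12.
Qed.

Lemma ge0_integral_comp_invariant d1 d2 (T1 : measurableType d1)
    (T2 : measurableType d2) (R : realType) (phi : T1 -> T2)
    (m1 : {measure set T1 -> \bar R}) (m2 : {measure set T2 -> \bar R})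
    (f : T2 -> \bar R) :
  measurable_fun setT phi ->
  (forall A, measurable A -> m1 (phi @^-1` A) = m2 A) ->
  measurable_fun setT f -> (forall y, 0 <= f y)%E ->
  (\int[m1]_x f (phi x) = \int[m2]_y f y)%E.
Proof.
move=> mphi m12 mf f0; rewrite -[RHS]mul1e.
apply: ge0_integral_comp_scale => // A mA.
by rewrite mul1e m12.
Qed.

(** * Translation invariance of Lebesgue measure *)

Section translation.
Variable R : realType.
Local Notation T := (measurableTypeR R).

Lemma measurable_addr (a : R) : measurable_fun setT ((fun x => x + a) : T -> T).
Proof. exact: measurable_funD. Qed.

Lemma lebesgue_measure_shift (a : R) (A : set T) : measurable A ->
  lebesgue_measure ((fun x : T => x + a) @^-1` A) = lebesgue_measure A.
Proof.
move=> mA; apply/esym.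
pose m : {measure set T -> \bar R} :=
  measure_function_pushforward__canonical__measure_function_Measure
    (@lebesgue_measure R) (measurable_addr a).
apply: (@lebesgue_measure_unique R m) mA => _ [[x y] _ <-] /=.
rewrite /m /= /pushforward (_ : _ @^-1` _ = `](x - a), (y - a)]%classic).
  rewrite !lebesgue_measure_itv/= !lte_fin ltrD2r.
  by case: ifPn => // _; rewrite -!EFinD; congr (_%:E); ring.
by apply/seteqP; split=> t /=; rewrite !in_itv/= ltrBlDr lerBrDr.
Qed.

Definition tuple_add n (x y : n.-tuple T) : n.-tuple T :=
  [tuple tnth x i + tnth y i | i < n].
Definition tuple_opp n (x : n.-tuple T) : n.-tuple T :=
  [tuple - tnth x i | i < n].

Lemma tuple_addC n : commutative (@tuple_add n).
Proof.
by move=> x y; apply: eq_from_tnth => i; rewrite !tnth_mktuple addrC.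
Qed.

Lemma tuple_addK n (x y : n.-tuple T) :
  tuple_add (tuple_add x y) (tuple_opp y) = x.
Proof. by apply: eq_from_tnth => i; rewrite !tnth_mktuple addrK. Qed.

Lemma tuple_oppD n (x y : n.-tuple T) :
  tuple_opp (tuple_add x (tuple_opp y)) = tuple_add y (tuple_opp x).
Proof. by apply: eq_from_tnth => i; rewrite !tnth_mktuple opprB. Qed.

Lemma measurable_tuple_add n d (S : measurableType d) (f g : S -> n.-tuple T) :
  measurable_fun setT f -> measurable_fun setT g ->
  measurable_fun setT (fun x => tuple_add (f x) (g x)).
Proof.
move=> mf mg; apply/measurable_fun_tnthP => i.
rewrite (_ : _ \o _ = (fun x => tnth (f x) i + tnth (g x) i)); last first.
  by apply/funext => x /=; rewrite tnth_mktuple.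
by apply: measurable_funD; exact: (measurableT_comp (measurable_tnth i)).
Qed.

Lemma measurable_tuple_opp n d (S : measurableType d) (f : S -> n.-tuple T) :
  measurable_fun setT f -> measurable_fun setT (fun x => tuple_opp (f x)).
Proof.
move=> mf; apply/measurable_fun_tnthP => i.
rewrite (_ : _ \o _ = (fun x => - tnth (f x) i)); last first.
  by apply/funext => x /=; rewrite tnth_mktuple.
apply: measurableT_comp; first exact: oppr_measurable.
exact: (measurableT_comp (measurable_tnth i)).
Qed.

Lemma measurable_preimage d1 d2 (T1 : measurableType d1)
    (T2 : measurableType d2) (f : T1 -> T2) (A : set T2) :
  measurable_fun setT f -> measurable A -> measurable (f @^-1` A).
Proof. by move=> mf mA; rewrite -[X in measurable X]setTI; exact: mf. Qed.

Definition cons_pair n (p : T * n.-tuple T) : n.+1.-tuple T :=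
  [the n.+1.-tuple _ of p.1 :: p.2].

Lemma measurable_cons_pair n : measurable_fun setT (@cons_pair n).
Proof. exact: measurable_cons. Qed.

Lemma lebesgueBS n (A : set (n.+1.-tuple T)) :
  lebesgueB A = (lebesgue_measure \x @lebesgueB R n)%E (@cons_pair n @^-1` A).
Proof. by []. Qed.

(** Induction through Tonelli: the shift by a moves the slice at t to the slice at t plus the head
    of a, and acts inside it as the shift by the tail of a. *)
Lemma lebesgueB_shift n (a : n.-tuple T) (A : set (n.-tuple T)) :
  measurable A -> lebesgueB ((fun x => tuple_add x a) @^-1` A) = lebesgueB A.
Proof.
elim: n a A => [|n IH] a A mA.
  congr (lebesgueB _); apply/seteqP.
  by split=> x /=; rewrite (tuple0 x) (tuple0 (tuple_add _ _)).
rewrite !lebesgueBS.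
have mA' : measurable (@cons_pair n @^-1` A).
  exact: measurable_preimage (@measurable_cons_pair n) mA.
rewrite /product_measure1 /=.
pose h (t : T) := @lebesgueB R n (xsection (@cons_pair n @^-1` A) t).
transitivity (\int[@lebesgue_measure R]_t h (t + tnth a ord0)%R)%E; last first.
  apply: (@ge0_integral_comp_invariant _ _ T T R (fun t : T => t + tnth a ord0)
    (@lebesgue_measure R) (@lebesgue_measure R) h (measurable_addr _)).
  - exact: lebesgue_measure_shift.
  - exact: (measurable_fun_xsection (@lebesgueB R n) mA').
  - by move=> y; exact: measure_ge0.
apply: eq_integral => t _; rewrite /h /=.
rewrite -(IH [tuple of behead a] _ (measurable_xsection (t + tnth a ord0) mA')).
congr (lebesgueB _); apply/seteqP.
have E z : tuple_add (cons_pair (t, z)) a =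
    cons_pair (t + tnth a ord0, tuple_add z [tuple of behead a]).
  apply: eq_from_tnth => i; rewrite tnth_mktuple.
  case: (unliftP ord0 i) => [j|] ->.
    rewrite !tnthS tnth_mktuple; congr (_ + _).
    by rewrite !(tnth_nth 0) /= nth_behead.
  by rewrite !tnth0.
by split=> z /=; rewrite /xsection /= !inE /= E.
Qed.

End translation.

(** * Uniqueness of Haar measure on R^n *)

Section haar.
Variables (R : realType) (n : nat).
Local Notation T := (n.-tuple (measurableTypeR R)).
Local Open Scope ereal_scope.

Definition translation_invariant (mu : set T -> \bar R) := forall a A,
  measurable A -> mu ((fun x => tuple_add x a) @^-1` A) = mu A.

Lemma integral_measure_sections (m1 m2 : {sigma_finite_measure set T -> \bar R})
    (S : set (T * T)) : measurable S ->
  \int[m1]_x m2 (xsection S x) = \int[m2]_y m1 (ysection S y).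
Proof.
move=> mS; have := @indic_fubini_tonelli _ _ T T R m1 m2 S mS.
by rewrite (indic_fubini_tonelli_FE m2 mS) (indic_fubini_tonelli_GE m1 mS).
Qed.

(* For mu A = 1 this reads nu = nu (- A) * mu: Haar measure is unique up to a
   factor. *)
Lemma translation_invariant_exchange
    (mu nu : {sigma_finite_measure set T -> \bar R}) (A E : set T) :
  translation_invariant mu -> translation_invariant nu ->
  measurable A -> measurable E ->
  mu A * nu E = mu E * nu (@tuple_opp R n @^-1` A).
Proof.
move=> muT nuT mA mE.
have madd := measurable_tuple_add (@measurable_fst _ _ T T)
  (@measurable_snd _ _ T T).
have msub := measurable_tuple_add (@measurable_fst _ _ T T)
  (measurable_tuple_opp (@measurable_snd _ _ T T)).
(* Both products are product measures of sets: [S1] integrated over x gives mu A * nu E, and [S2]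
   gives mu E * nu (- A). The shear (x, y) -> (x + y, y) carries [S1] to [S2], and at fixed y it is
   a translation, which preserves [mu]. *)
pose S1 := [set p : T * T | A p.1 /\ E (tuple_add p.1 p.2)].
pose S2 := [set p : T * T | E p.1 /\ A (tuple_add p.1 (tuple_opp p.2))].
have mS1 : measurable S1.
  apply: measurableI; last exact: measurable_preimage madd mE.
  exact: measurable_preimage (@measurable_fst _ _ T T) mA.
have mS2 : measurable S2.
  apply: measurableI; last exact: measurable_preimage msub mA.
  exact: measurable_preimage (@measurable_fst _ _ T T) mE.
have mNA : measurable (@tuple_opp R n @^-1` A).
  exact: measurable_preimage
    (measurable_tuple_opp (@measurable_id _ T setT)) mA.
transitivity (\int[mu]_x nu (xsection S1 x)).
  rewrite muleC -integral_cst// integral_mkcond; apply: eq_integral => x _.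
  rewrite patchE; case: ifPn => [/set_mem Ax|/negP Ax].
    rewrite /= -(nuT x _ mE); congr (nu _); apply/seteqP.
    split=> y; rewrite /xsection /S1 /= inE /= tuple_addC; first by split.
    by case.
  rewrite (_ : xsection S1 x = set0) ?measure0//.
  apply/seteqP; split=> y //; rewrite /xsection /S1 /= inE /= => -[Ax' _].
  by apply: Ax; rewrite inE.
rewrite integral_measure_sections//.
transitivity (\int[nu]_y mu (ysection S2 y)).
  apply: eq_integral => y _.
  rewrite -(muT y _ (measurable_ysection y mS2)); congr (mu _); apply/seteqP.
  by split=> x; rewrite /ysection /S1 /S2 /= !inE /= tuple_addK => -[].
rewrite -integral_measure_sections// muleC -integral_cst// integral_mkcond.
apply: eq_integral => x _; rewrite patchE; case: ifPn => [/set_mem Ex|/negP Ex].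
  rewrite /= -(nuT (tuple_opp x) _ mNA); congr (nu _); apply/seteqP.
  split=> y; rewrite /xsection /S2 /= inE /= tuple_oppD; last by split.
  by case.
rewrite (_ : xsection S2 x = set0) ?measure0//.
apply/seteqP; split=> y //; rewrite /xsection /S2 /= inE /= => -[Ex' _].
by apply: Ex; rewrite inE.
Qed.

End haar.

(** * Scaling of Lebesgue measure by linear bijections *)

Section lebesgueB_scale.
Variable R : realType.
Local Notation T := (measurableTypeR R).
Local Open Scope ereal_scope.

Lemma measurable_uncons n : measurable_fun setT
  (fun y : n.+1.-tuple T => (tnth y ord0, [tuple of behead y])).
Proof.
by apply/measurable_fun_pairP; split;
  [exact: measurable_tnth|exact: measurable_behead].
Qed.

(** The unit cube, which normalises the exchange identity between invariant measures. *)
Lemma lebesgueB_unit_set n :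
  exists A : set (n.-tuple T), measurable A /\ lebesgueB A = 1.
Proof.
elim: n => [|n [A [mA A1]]].
  by exists setT; split => //=; rewrite diracT.
pose B := (fun y : n.+1.-tuple T => (tnth y ord0, [tuple of behead y]))
  @^-1` (`[0%R, 1%R]%classic `*` A).
have mB : measurable B.
  apply: measurable_preimage (@measurable_uncons n) _.
  exact: measurableX.
exists B; split => //.
rewrite lebesgueBS (_ : _ @^-1` _ = `[0%R, 1%R]%classic `*` A); last first.
  rewrite /B -comp_preimage (_ : _ \o _ = id) ?preimage_id//.
  by apply/funext => -[t z]; congr pair; exact/val_inj.
rewrite product_measure1E//= A1 mule1 lebesgue_measure_itv/= lte_fin ltr01.
by rewrite -EFinD subr0.
Qed.

(** The image of Lebesgue measure under phi is translation invariant because phi is additive, and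
    sigma-finite because psi is measurable; hence it is a multiple of Lebesgue measure. *)
Lemma lebesgueB_scale n (phi psi : n.-tuple T -> n.-tuple T) :
  measurable_fun setT phi -> measurable_fun setT psi ->
  cancel phi psi -> cancel psi phi ->
  {morph phi : x y / tuple_add x y} ->
  exists2 c : R, (0 < c)%R & forall A, measurable A ->
    lebesgueB (phi @^-1` A) = c%:E * lebesgueB A.
Proof.
move=> mphi mpsi phiK psiK phiD.
pose mu := @lebesgueB R n.
pose nu0 : {measure set (n.-tuple T) -> \bar R} :=
  measure_function_pushforward__canonical__measure_function_Measure mu mphi.
have nu0_sf : sigma_finite setT nu0.
  have [F FT Ffin] := sigma_finiteT mu.
  exists (fun k => psi @^-1` F k).
    by rewrite -preimage_bigcup -FT.
  move=> k; have [mF Foo] := Ffin k; split.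
    exact: measurable_preimage mpsi mF.
  rewrite /nu0 /= /pushforward -comp_preimage (_ : _ \o _ = id) ?preimage_id//.
  by apply/funext => x /=; rewrite phiK.
pose nu1 := @Measure_isSigmaFinite.Build _ _ _ nu0 nu0_sf.
pose nu : {sigma_finite_measure set (n.-tuple T) -> \bar R} :=
  HB.pack (nu0 : set _ -> \bar R) nu0 nu1.
have nuE A : nu A = lebesgueB (phi @^-1` A) by [].
have muT : translation_invariant mu by move=> a A; exact: lebesgueB_shift.
have nuT : translation_invariant nu.
  move=> a A mA; rewrite !nuE.
  rewrite -(lebesgueB_shift (psi a) (measurable_preimage mphi mA)).
  congr (lebesgueB _); apply/seteqP.
  by split=> x /=; rewrite phiD psiK.
have [A [mA A1]] := lebesgueB_unit_set n.
pose k := nu (@tuple_opp R n @^-1` A).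
have nuk E : measurable E -> nu E = k * mu E.
  move=> mE; have H : mu A * nu E = mu E * k.
    exact: (translation_invariant_exchange muT nuT mA mE).
  by rewrite muleC -H /mu A1 mul1e.
have T0 : 0 < mu setT.
  apply: (@lt_le_trans _ _ (mu A)); first by rewrite [mu A]A1.
  by apply: le_measure; rewrite ?inE.
have k0 : 0 < k.
  rewrite lt0e measure_ge0 andbT; apply/eqP => k0.
  have := nuk setT measurableT.
  by rewrite k0 mul0e nuE preimage_setT => T0'; rewrite [mu _]T0' ltxx in T0.
(* With an infinite factor every set of finite [nu]-measure would be Lebesgue null, and countably
   many such sets cover the space. *)
have koo : k < +oo.
  rewrite ltey; apply/eqP => koo.
  have [F FT Ffin] := sigma_finiteT nu.
  have : mu (\bigcup_i F i) = 0.
    apply: measure_bigcup0 => i; first by case: (Ffin i).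
    have [mF Foo] := Ffin i.
    apply/eqP; rewrite eq_le measure_ge0 andbT leNgt; apply/negP => F0.
    suff : nu (F i) = +oo by move=> Fioo; move: Foo; rewrite [X in X < _]Fioo.
    by rewrite (nuk _ mF) koo gt0_mulye.
  by rewrite -FT => T0'; rewrite T0' ltxx in T0.
have kfin : k \is a fin_num by rewrite ge0_fin_numE// ltW.
exists (fine k); first by rewrite fine_gt0// k0 koo.
by move=> B mB; rewrite fineK// -nuk.
Qed.

End lebesgueB_scale.

(* Slicing Rn m.+1 along the maps K t turns the Lebesgue measure of Rn m.+1
   into c^-1 times the product of the Lebesgue measures of R and Rn m. *)
Definition disintegrates (R : realType) (m : nat) (c : R)
    (K : measurableTypeR R -> Rn R m -> Rn R m.+1) :=
  (forall F : Rn R m.+1 -> R, measurable_fun setT F ->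
    (forall x, 0 <= F x)%R ->
    exists G : measurableTypeR R -> \bar R,
      [/\ measurable_fun setT G, (forall t, 0 <= G t),
      \int[lebesgue_measure]_t G t = c%:E * \int[@lebesgue R m.+1]_x (F x)%:E &
      {ae @lebesgue_measure R, forall t,
        measurable_fun setT (F \o K t) /\
        \int[@lebesgue R m]_z (F (K t z))%:E = G t}])%E.

(** * Disintegration of complete Lebesgue measure *)

Section disintegration.
Variables (R : realType) (m : nat).
Local Notation T := (measurableTypeR R).
Variables (Psi PsiV : m.+1.-tuple T -> m.+1.-tuple T).
Hypotheses (mPsi : measurable_fun setT Psi) (mPsiV : measurable_fun setT PsiV)
  (PsiK : cancel Psi PsiV) (PsiVK : cancel PsiV Psi)
  (PsiD : {morph Psi : x y / tuple_add x y}).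
Local Open Scope ereal_scope.

Let K (t : T) (z : m.-tuple T) : m.+1.-tuple T := Psi (cons_pair (t, z)).

Let measurable_K (t : T) : measurable_fun setT (K t).
Proof.
apply: (measurableT_comp mPsi).
apply: (measurableT_comp (@measurable_cons_pair R m)).
exact: pair1_measurable.
Qed.

(** [Psi] pulls [N] back to a null set; the measures of its sections integrate to zero and so vanish
    almost everywhere. No more than almost every t can be expected, as [N] may contain whole
    slices. *)
Let borel_slice_null (N : set (m.+1.-tuple T)) :
  measurable N -> lebesgueB N = 0 ->
  {ae @lebesgue_measure R, forall t, @lebesgueB R m (K t @^-1` N) = 0}.
Proof.
move=> mN N0.
have [c c0 scale] := lebesgueB_scale mPsi mPsiV PsiK PsiVK PsiD.
have mN' : measurable (@cons_pair R m @^-1` (Psi @^-1` N)).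
  apply: measurable_preimage (@measurable_cons_pair R m) _.
  exact: measurable_preimage mPsi mN.
have : lebesgueB (Psi @^-1` N) = 0 by rewrite scale// N0 mule0.
rewrite lebesgueBS => N0'.
have mf := measurable_fun_xsection (@lebesgueB R m) mN'.
have : ae_eq (@lebesgue_measure R) setT
    (@lebesgueB R m \o xsection (@cons_pair R m @^-1` (Psi @^-1` N))) (cst 0).
  apply/(ae_eq_integral_abs _ _ mf) => //.
  rewrite -[RHS]N0'; apply: eq_integral => t _ /=.
  by rewrite gee0_abs.
apply: filterS => t /(_ I) /= H; rewrite -[RHS]H; congr (lebesgueB _).
by apply/seteqP; split=> z; rewrite /xsection /= inE.
Qed.

Lemma lebesgue_tonelli : exists2 c : R, (0 < c)%R & disintegrates c K.
Proof.
have [c c0 scale] := lebesgueB_scale mPsi mPsiV PsiK PsiVK PsiD.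
exists c => // F mF F0.
have [g [N [mg mN N0 Fg]]] := completed_measurable_fun_borel mF.
pose h x : \bar R := `|g x|%:E.
have mh : measurable_fun setT h.
  apply/measurable_EFinP.
  exact: (measurableT_comp (@normr_measurable R setT) mg).
have h0 x : 0 <= h x by rewrite lee_fin.
have Fh x : ~ N x -> (F x)%:E = h x.
  by move=> Nx; rewrite /h -Fg// ger0_norm.
have intF : \int[@lebesgue R m.+1]_x (F x)%:E = \int[@lebesgueB R m.+1]_x h x.
  by apply: (@ge0_integral_completed _ _ R (@lebesgueB R m.+1) _ h N).
pose H (p : T * m.-tuple T) := h (Psi (cons_pair p)).
have mH : measurable_fun setT H.
  apply: (measurableT_comp mh); apply: (measurableT_comp mPsi).
  exact: measurable_cons_pair.
have H0 p : 0 <= H p by exact: h0.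
exists (fubini_F (@lebesgueB R m) H); split.
- exact: measurable_fun_fubini_tonelli_F.
- by move=> t; apply: integral_ge0 => z _.
- rewrite -(fubini_tonelli1 H)// intF.
  rewrite -(@ge0_integral_comp_scale _ _ _ _ R Psi (@lebesgueB R m.+1)
    (@lebesgueB R m.+1) c h mPsi (ltW c0) scale mh h0).
  have mhPsi : measurable_fun setT (fun x => h (Psi x)).
    exact: (measurableT_comp mh).
  exact: (@ge0_integral_comp_invariant _ _ _ _ R (@cons_pair R m)
    (@lebesgue_measure R \x @lebesgueB R m) (@lebesgueB R m.+1)
    (fun x => h (Psi x)) (@measurable_cons_pair R m) (fun A _ => erefl)
    mhPsi (fun x => h0 _)).
- have := borel_slice_null mN N0; apply: filterS => t Nt0.
  have mKN : measurable (K t @^-1` N).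
    exact: measurable_preimage (measurable_K t) mN.
  have mhK : measurable_fun setT (fun z => h (K t z)).
    exact: (measurableT_comp mh).
  have FhK z : ~ (K t @^-1` N) z -> (F (K t z))%:E = h (K t z).
    exact: Fh.
  split.
    apply/measurable_EFinP.
    exact: (@completed_ae_measurable _ _ R (@lebesgueB R m) _ _ _ mhK mKN Nt0 FhK).
  apply: (@ge0_integral_completed _ _ R (@lebesgueB R m) _ _ _ mhK mKN Nt0 FhK).
    by move=> x; rewrite lee_fin.
  by move=> x; exact: h0.
Qed.

End disintegration.

(** * Fubini along slices for integrable functions *)

Section slices.
Variables (R : realType) (m : nat) (c : R).
Variable K : measurableTypeR R -> Rn R m -> Rn R m.+1.
Hypotheses (c_gt0 : 0 < c) (disK : disintegrates c K).
Local Notation T := (measurableTypeR R).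
Local Notation mu := (@lebesgue R m.+1).
Local Notation mu' := (@lebesgue R m).
Local Notation leb := (@lebesgue_measure R).

Lemma lebesgue_fubini (F : Rn R m.+1 -> R) :
  mu.-integrable setT (EFin \o F) ->
  exists G : T -> R, [/\ leb.-integrable setT (EFin \o G),
    \int[leb]_t G t = c * \int[mu]_x F x &
    {ae leb, forall t, mu'.-integrable setT (EFin \o (F \o K t)) /\
      \int[mu']_z F (K t z) = G t}].
Proof.
move=> iF.
have mF : measurable_fun setT F by exact/measurable_EFinP/(measurable_int mu iF).
have iFp := integrable_funrpos measurableT iF.
have iFn := integrable_funrneg measurableT iF.
have half (H : Rn R m.+1 -> R) : (forall x, 0 <= H x) ->
    mu.-integrable setT (EFin \o H) ->
    exists G : T -> R, [/\ leb.-integrable setT (EFin \o G),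
    \int[leb]_t G t = c * \int[mu]_x H x &
    {ae leb, forall t, mu'.-integrable setT (EFin \o (H \o K t)) /\
      \int[mu']_z H (K t z) = G t}].
  move=> H0 iH.
  have mH : measurable_fun setT H by exact/measurable_EFinP/(measurable_int mu iH).
  have [G [mG G0 intG aeG]] := disK mH H0.
  have Goo : (\int[leb]_t G t < +oo)%E.
    by rewrite intG lte_mul_pinfty// ?lee_fin 1?ltW//; exact: integrable_lty.
  have iG : leb.-integrable setT G.
    apply/integrableP; split => //.
    by under eq_integral do rewrite gee0_abs//.
  have aeGfin := integrable_ae measurableT iG.
  (* [G] is finite only almost everywhere; [fine] sends its infinite values to 0. *)
  have mfG : measurable_fun setT (EFin \o (fine \o G)).
    apply/measurable_EFinP; exact: (measurableT_comp (@fine_measurable R setT measurableT) mG).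
  have aeE : ae_eq leb setT (EFin \o (fine \o G)) G.
    by apply: filterS aeGfin => t Gt _ /=; rewrite fineK// Gt.
  exists (fine \o G); split.
  - apply/integrableP; split => //.
    rewrite (_ : integral _ _ _ = \int[leb]_t `|G t|)%E; last first.
      apply: ae_eq_integral => //; try exact: measurableT_comp.
      by apply: filterS aeE => t /(_ I) H' _; rewrite -H'.
    by case/integrableP : iG.
  - rewrite /Rintegral (ae_eq_integral G) // intG fineM//.
    exact: integrable_fin_num.
  - move: aeGfin aeG; apply: filterS2 => t Gt [mHt intHt].
    have Gtfin : G t \is a fin_num by exact: Gt.
    split; last by rewrite /Rintegral intHt.
    apply/integrableP; split; first exact/measurable_EFinP.
    rewrite (_ : integral _ _ _ = G t); first by rewrite ltey_eq Gtfin.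
    rewrite -intHt; apply: eq_integral => z _ /=.
    by rewrite ger0_norm.
have [Gp [iGp intGp aeGp]] := half _ (fun x => funrpos_ge0 F x) iFp.
have [Gn [iGn intGn aeGn]] := half _ (fun x => funrneg_ge0 F x) iFn.
have FE x : F x = F^\+ x - F^\- x.
  by rewrite -[in LHS](funrposBneg F).
exists (fun t => Gp t - Gn t); split.
- exact: (integrableB measurableT iGp iGn).
- rewrite RintegralB// intGp intGn -mulrBr; congr (_ * _).
  by rewrite -RintegralB//; apply: eq_Rintegral => x _; rewrite -FE.
- move: aeGp aeGn; apply: filterS2 => t [ip <-] [ine <-]; split.
    apply: eq_integrable (integrableB measurableT ip ine) => //.
    by move=> z _ /=; rewrite FE.
  rewrite -RintegralB//; apply: eq_Rintegral => z _.
  by rewrite FE.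
Qed.

(** The form in which disintegration serves orthogonality: whether an integral vanishes does not
    depend on the constant c. *)
Lemma slice_integral0 (F : Rn R m.+1 -> R) :
  mu.-integrable setT (EFin \o F) ->
  {ae leb, forall t, \int[mu']_z F (K t z) = 0} ->
  \int[mu]_x F x = 0.
Proof.
move=> iF F0; have [G [iG intG aeG]] := lebesgue_fubini iF.
have : \int[leb]_t G t = 0.
  rewrite /Rintegral (ae_eq_integral (cst 0%E)) ?integral0//.
    exact: (measurable_int _ iG).
  by move: aeG F0; apply: filterS2 => t [_ <-] -> _.
by rewrite intG => /eqP; rewrite mulf_eq0 gt_eqF//= => /eqP.
Qed.

End slices.

(** * The inner product of L_2(X) *)

Section lfun2.
Context d (T : measurableType d) (R : realType).
Variable mu : {measure set T -> \bar R}.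
Implicit Types f g : T -> R.

Lemma poweR2E (x : R) : (`|x%:E| `^ 2%R)%E = (x ^+ 2)%:E.
Proof. by rewrite poweR_EFin powR_mulrn// real_normK ?num_real. Qed.

Lemma Lfun2P f : f \in Lfun mu 2%:E <->
  measurable_fun setT f /\ mu.-integrable setT (fun x => (f x ^+ 2)%:E).
Proof.
split=> [f2|[mf /(integrable_lty measurableT) f2]].
  split; last exact: Lfun2_integrable_sqr.
  by have := sub_Lfun_mfun f2; rewrite inE.
rewrite inE; apply/andP; split; rewrite inE//=.
rewrite /finite_norm unlock poweR_lty//.
rewrite (eq_integral (fun x => (f x ^+ 2)%:E))// => x _; exact: poweR2E.
Qed.

Lemma Lfun2_mul_integrable f g : f \in Lfun mu 2%:E -> g \in Lfun mu 2%:E ->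
  mu.-integrable setT (fun x => (f x * g x)%:E).
Proof. by move=> f2 g2; exact/Lfun1_integrable/Lfun2_mul_Lfun1. Qed.

End lfun2.

(** Restriction as multiplication suits slicing, since the indicator of a product factors. *)
Lemma restrict_indicE (T : Type) (R : realType) (X : set T) (f : T -> R) x :
  (f \_ X) x = \1_X x * f x.
Proof.
by rewrite patchE indicE; case: ifP => _; rewrite ?mul1r ?mul0r.
Qed.

Section restricted_L2.
Context (R : realType) (n : nat).
Local Notation mu := (@lebesgue R n).
Variable X : set (Rn R n).
Hypotheses (mX : measurable X) (X_lty : (mu X < +oo)%E).
Implicit Types u v : Rn R n -> R.

Lemma integrable_indic_lty : mu.-integrable setT (EFin \o \1_X).
Proof.
apply/integrableP; split; first exact/measurable_EFinP/measurable_indic.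
rewrite (eq_integral (EFin \o \1_X)); last first.
  by move=> x _; rewrite /= ger0_norm.
by rewrite integral_indic// setIT.
Qed.

Lemma in_L2_cst (e : R) : in_L2 X (fun=> e).
Proof.
have m1 : measurable_fun setT (\1_X : Rn R n -> R).
  exact: measurable_indic.
apply/Lfun2P; split.
  apply: eq_measurable_fun (measurable_funM m1 (measurable_cst e)) => // x _.
  by rewrite restrict_indicE.
have := integrable_indic_lty.
move=> /(integrableZl measurableT (e ^+ 2)).
apply: eq_integrable => // x _.
rewrite restrict_indicE indicE /= indicE -EFinM; congr (_%:E).
by case: (_ \in _) => /=; ring.
Qed.

Lemma in_L2D u v : in_L2 X u -> in_L2 X v -> in_L2 X (fun x => u x + v x).
Proof.
move=> u2 v2; rewrite /in_L2 (_ : _ \_ _ = (u \_ X) + (v \_ X)).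
  exact: (Lfun_addr_closed mu (lee1n 2)).2.
by apply/funext => x; rewrite fctE !restrict_indicE mulrDr.
Qed.

Lemma in_L2Z (e : R) u : in_L2 X u -> in_L2 X (fun x => e * u x).
Proof.
move=> u2; rewrite /in_L2 (_ : _ \_ _ = e \o* (u \_ X)).
  by apply: Lfun_scale => //; rewrite ler1n.
by apply/funext => x; rewrite /= !restrict_indicE; ring.
Qed.

Lemma in_L2N u : in_L2 X u -> in_L2 X (fun x => - u x).
Proof.
move=> /(in_L2Z (-1)); rewrite (_ : (fun x => -1 * u x) = (fun x => - u x))//.
by apply/funext => x; rewrite mulN1r.
Qed.

Lemma in_L2B u v : in_L2 X u -> in_L2 X v -> in_L2 X (fun x => u x - v x).
Proof. by move=> u2 /in_L2N; exact: in_L2D. Qed.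

Lemma in_L2_sum (I : Type) (s : seq I) (P : pred I) (F : I -> Rn R n -> R) :
  (forall i, in_L2 X (F i)) -> in_L2 X (fun x => \sum_(i <- s | P i) F i x).
Proof.
move=> F2; elim: s => [|i s IH].
  rewrite (_ : (fun x => _) = (fun=> 0)); first exact: in_L2_cst.
  by apply/funext => x; rewrite big_nil.
rewrite (_ : (fun x => _) = (fun x => (if P i then F i x else 0) +
    \sum_(j <- s | P j) F j x)); last first.
  by apply/funext => x; rewrite big_cons; case: ifP; rewrite ?add0r.
by apply: in_L2D => //; case: (P i) => //; exact: in_L2_cst.
Qed.

Definition inner u v : R := \int[mu]_x (\1_X x * (u x * v x)).

Lemma integrable_inner u v : in_L2 X u -> in_L2 X v ->
  mu.-integrable setT (EFin \o (fun x => \1_X x * (u x * v x))).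
Proof.
move=> u2 v2; apply: eq_integrable (Lfun2_mul_integrable u2 v2) => // x _.
rewrite /= !restrict_indicE mulrACA indicE.
by case: (_ \in _); rewrite ?mul1r ?mul0r.
Qed.

Lemma innerDl u1 u2 v : in_L2 X u1 -> in_L2 X u2 -> in_L2 X v ->
  inner (fun x => u1 x + u2 x) v = inner u1 v + inner u2 v.
Proof.
move=> h1 h2 h; rewrite /inner -RintegralD//; try exact: integrable_inner.
by apply: eq_Rintegral => x _; ring.
Qed.

Lemma innerC u v : inner u v = inner v u.
Proof. by apply: eq_Rintegral => x _; ring. Qed.

Lemma innerZl (e : R) u v : in_L2 X u -> in_L2 X v ->
  inner (fun x => e * u x) v = e * inner u v.
Proof.
move=> hu hv; rewrite /inner -RintegralZl//; last exact: integrable_inner.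
by apply: eq_Rintegral => x _; ring.
Qed.

Lemma innerBl u1 u2 v : in_L2 X u1 -> in_L2 X u2 -> in_L2 X v ->
  inner (fun x => u1 x - u2 x) v = inner u1 v - inner u2 v.
Proof.
move=> h1 h2 h; rewrite /inner -RintegralB//; try exact: integrable_inner.
by apply: eq_Rintegral => x _; ring.
Qed.

Lemma inner_suml (I : Type) (s : seq I) (P : pred I) (F : I -> Rn R n -> R) v :
  (forall i, in_L2 X (F i)) -> in_L2 X v ->
  inner (fun x => \sum_(i <- s | P i) F i x) v =
    \sum_(i <- s | P i) inner (F i) v.
Proof.
move=> F2 v2; elim: s => [|i s IH].
  rewrite big_nil (_ : (fun x => _) = (fun x => 0 * v x)); last first.
    by apply/funext => x; rewrite big_nil mul0r.
  by rewrite innerZl// mul0r.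
rewrite big_cons -IH.
rewrite (_ : (fun x => _) = (fun x => (if P i then F i x else 0) +
    \sum_(j <- s | P j) F j x)); last first.
  by apply/funext => x; rewrite big_cons; case: ifP; rewrite ?add0r.
case: ifP => Pi.
  by rewrite innerDl//; exact: in_L2_sum.
by congr inner; apply/funext => x; rewrite add0r.
Qed.

Lemma inner_ge0 u : 0 <= inner u u.
Proof. by apply: Rintegral_ge0 => x _; rewrite mulr_ge0// -expr2 sqr_ge0. Qed.

Lemma L2normE u : in_L2 X u -> L2norm X u = (Num.sqrt (inner u u))%:E.
Proof.
move=> u2; rewrite /L2norm unlock.
rewrite (_ : (\int[_]_x _)%E = (inner u u)%:E).
  by rewrite poweR_EFin powR12_sqrt//; exact: inner_ge0.
rewrite /inner fineK.
  apply: eq_integral => x _; apply: (etrans (poweR2E _)); congr (_%:E).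
  by rewrite restrict_indicE indicE; case: (_ \in _) => /=; ring.
by apply: (integrable_fin_num measurableT); exact: integrable_inner.
Qed.

(** Pythagoras: the cross terms vanish and what is added is a squared norm. *)
Lemma L2norm_le_orthogonal u v : in_L2 X u -> in_L2 X v -> inner u v = 0 ->
  (L2norm X u <= L2norm X (fun x => u x + v x)%R)%E.
Proof.
move=> u2 v2 uv0; have uv2 := in_L2D u2 v2.
rewrite !L2normE// lee_fin ler_wsqrtr// innerDl// (innerC u) (innerC v).
by rewrite !innerDl// (innerC v u) uv0 addr0 add0r lerDl inner_ge0.
Qed.

End restricted_L2.

Lemma Rintegral_eq0 d (T : measurableType d) (R : realType)
    (mu : {measure set T -> \bar R}) (f : T -> R) :
  (forall x, f x = 0) -> \int[mu]_x f x = 0.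
Proof. by move=> f0; rewrite /Rintegral integral0_eq// => x _; rewrite f0. Qed.

(** * Means over slices of a set with product structure *)

Section product_slices.
Variables (R : realType) (m : nat) (c : R).
Variable K : measurableTypeR R -> Rn R m -> Rn R m.+1.
Hypotheses (c_gt0 : 0 < c) (disK : disintegrates c K).
Local Notation T := (measurableTypeR R).
Local Notation mu := (@lebesgue R m.+1).
Local Notation mu' := (@lebesgue R m).
Local Notation leb := (@lebesgue_measure R).
Variables (X : set (Rn R m.+1)) (Yi : set R) (Zi : set (Rn R m)).
Variable pr : Rn R m.+1 -> T.
Hypotheses (mX : measurable X) (X_gt0 : (0 < mu X)%E) (X_lty : (mu X < +oo)%E).
Hypothesis XK : forall t z, X (K t z) <-> Yi t /\ Zi z.
Hypothesis Xpr : forall x, X x -> Yi (pr x).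
Hypotheses (mpr : measurable_fun setT pr) (prK : forall t z, pr (K t z) = t).

Lemma indic_slice t z : \1_X (K t z) = \1_Yi t * \1_Zi z :> R.
Proof.
rewrite !indicE; have [Yt|Yt] := pselect (Yi t); last first.
  by rewrite (memNset Yt) memNset ?mul0r// => H; case: (XK t z).1.
have [Zz|Zz] := pselect (Zi z); last first.
  by rewrite (memNset Zz) memNset ?mulr0// => H; case: (XK t z).1.
by rewrite !mem_set ?mulr1//; apply/XK.
Qed.

Lemma Rintegral_indic_gt0 : 0 < \int[mu]_x \1_X x.
Proof.
by rewrite /Rintegral integral_indic// setIT fine_gt0// X_gt0.
Qed.

(** [Yi] is not null: otherwise almost every slice of X would be empty and X would be null. *)
Lemma ex_slice (P : T -> Prop) : {ae leb, forall t, P t} ->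
  exists2 t : T, Yi t & P t.
Proof.
move=> aeP; apply: contrapT => nex.
have := Rintegral_indic_gt0.
rewrite (slice_integral0 c_gt0 disK (integrable_indic_lty mX X_lty)) ?ltxx//.
apply: filterS aeP => t Pt; apply: Rintegral_eq0 => z.
rewrite indic_slice indicE memNset ?mul0r//.
by move=> Yt; apply: nex; exists t.
Qed.

(** Almost every slice of the indicator of X is integrable; [ex_slice] picks one over a point of
    [Yi], and that slice is the indicator of [Zi]. Measurability and finite measure of [Zi] both
    come from here. *)
Lemma indic_slice_integrable :
  mu'.-integrable setT (EFin \o (\1_Zi : Rn R m -> R)).
Proof.
have [G [_ _ aeG]] := lebesgue_fubini c_gt0 disK (integrable_indic_lty mX X_lty).
have [t Yt [it _]] := ex_slice aeG.
apply: eq_integrable it => // z _.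
by rewrite /= indic_slice [\1_Yi t]indicE mem_set// mul1r.
Qed.

Lemma measurable_slice : measurable Zi.
Proof.
have /(measurable_int mu')/measurable_EFinP mZ := indic_slice_integrable.
rewrite (_ : Zi = (\1_Zi : Rn R m -> R) @^-1` [set 1]).
  exact: measurable_preimage mZ (measurable_set1 _).
apply/seteqP; split=> z /=; rewrite indicE; first by move=> Zz; rewrite mem_set.
by case: (boolP (z \in Zi)) => [/set_mem//|_ /eqP]; rewrite eq_sym oner_eq0.
Qed.

Let V := fine (mu' Zi).

Lemma integral_slice : (\int[mu']_z (\1_Zi z)%:E = V%:E)%E.
Proof.
have := integrable_fin_num measurableT indic_slice_integrable.
rewrite integral_indic ?setIT; [|exact: measurableT|exact: measurable_slice].
by move=> ?; rewrite /V fineK.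
Qed.

Lemma Rintegral_slice : \int[mu']_z \1_Zi z = V.
Proof. by rewrite /Rintegral integral_slice. Qed.

Lemma volume_slice_gt0 : 0 < V.
Proof.
rewrite lt_neqAle fine_ge0 ?measure_ge0// andbT eq_sym; apply/eqP => V0.
have := Rintegral_indic_gt0.
rewrite (slice_integral0 c_gt0 disK (integrable_indic_lty mX X_lty)) ?ltxx//.
apply: aeW => t.
rewrite (eq_Rintegral _ (g := fun z => \1_Yi t * \1_Zi z)); last first.
  by move=> z _; rewrite indic_slice.
rewrite RintegralZl//; last exact: indic_slice_integrable.
by rewrite Rintegral_slice V0 mulr0.
Qed.

(** For u = f and the coordinate slices this is |Y^(i)|^-1 f_i^* by conversion. *)
Let mean (u : Rn R m.+1 -> R) (t : R) : R :=
  V^-1 * \int[mu']_(z in Zi) u (K t z).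

Lemma mean_slice u t :
  \int[mu']_z (\1_Zi z * u (K t z)) = V * mean u t.
Proof.
rewrite /mean mulrA divff ?gt_eqF ?volume_slice_gt0// mul1r [in RHS]Rintegral_mkcond.
by apply: eq_Rintegral => z _; rewrite restrict_indicE.
Qed.

Lemma integrable_in_L2 u : in_L2 X u ->
  mu.-integrable setT (EFin \o (fun x => \1_X x * u x)).
Proof.
move=> u2; apply: eq_integrable (integrable_inner u2 (in_L2_cst mX X_lty 1)) => //.
by move=> x _; rewrite /= mulr1.
Qed.

Lemma integrable_sqr_in_L2 u : in_L2 X u ->
  mu.-integrable setT (EFin \o (fun x => \1_X x * u x ^+ 2)).
Proof. by move=> u2; exact: (integrable_inner u2 u2). Qed.

Lemma ae_slice_integrable (F : Rn R m.+1 -> R) :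
  mu.-integrable setT (EFin \o (fun x => \1_X x * F x)) ->
  {ae leb, forall t : T, Yi t ->
    mu'.-integrable setT (EFin \o (fun z => \1_Zi z * F (K t z)))}.
Proof.
move=> iF; have [G [_ _ aeG]] := lebesgue_fubini c_gt0 disK iF.
apply: filterS aeG => t [it _] Yt; apply: eq_integrable it => // z _.
by rewrite /= indic_slice [\1_Yi t]indicE mem_set// mul1r.
Qed.

Lemma inner_mean u k : in_L2 X u -> in_L2 X (mean u \o pr) ->
  in_L2 X (k \o pr) ->
  inner X (fun x => u x - mean u (pr x)) (k \o pr) = 0.
Proof.
move=> u2 p2 k2.
apply: (slice_integral0 c_gt0 disK).
  exact: (integrable_inner (in_L2B u2 p2) k2).
have := ae_slice_integrable (integrable_in_L2 u2); apply: filterS => t it.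
have [Yt|Yt] := pselect (Yi t); last first.
  apply: Rintegral_eq0 => z.
  by rewrite indic_slice [\1_Yi t]indicE memNset// !mul0r.
(* Over a point of [Yi] the factor k t is constant on the slice, and u minus its mean integrates to
   0. Integrability of the slice, known for almost every t, allows the integral to be split. *)
rewrite (eq_Rintegral _ (g := fun z => k t *
    (\1_Zi z * u (K t z) - mean u t * \1_Zi z))); last first.
  move=> z _; rewrite indic_slice [\1_Yi t]indicE mem_set// /= prK /=.
  by rewrite mul1r; ring.
have iZ := integrableZl measurableT (mean u t) indic_slice_integrable.
rewrite RintegralZl//; last first.
  exact: (integrableB measurableT (it Yt) iZ).
rewrite RintegralB//; last exact: it.
rewrite mean_slice RintegralZl//; last exact: indic_slice_integrable.
by rewrite Rintegral_slice mulrC [V * _]mulrC subrr mul0r.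
Qed.

(** On X the function w depends on z alone, so each slice over [Yi] contributes k t times one and
    the same number [C], and mean zero forces C = 0. *)
Lemma inner_cross w w' k : in_L2 X w -> in_L2 X (k \o pr) ->
  (forall t z, Yi t -> Zi z -> w (K t z) = w' z) ->
  inner X w (fun=> 1) = 0 -> inner X w (k \o pr) = 0.
Proof.
move=> w2 k2 ww' w0.
have iw := integrable_in_L2 w2.
have [t0 Yt0 /(_ Yt0) iw'] := ex_slice (ae_slice_integrable iw).
have {}iw' : mu'.-integrable setT (EFin \o (fun z => \1_Zi z * w' z)).
  apply: eq_integrable iw' => // z _; rewrite /= indicE.
  by case: (boolP (z \in Zi)) => [/set_mem Zz|]; rewrite ?mul0r// (ww' t0).
pose C := \int[mu']_z (\1_Zi z * w' z).
have slice t (k' : R -> R) : \int[mu']_z (\1_X (K t z) * (w (K t z) * k' t)) =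
    k' t * (\1_Yi t * C).
  rewrite /C mulrA -RintegralZl//; apply: eq_Rintegral => z _.
  rewrite indic_slice !indicE.
  have [Yt|Yt] := pselect (Yi t); last by rewrite (memNset Yt) /=; ring.
  have [Zz|Zz] := pselect (Zi z); last by rewrite (memNset Zz) /=; ring.
  by rewrite (ww' t)//; ring.
have C0 : C = 0.
  have i1 := integrable_indic_lty mX X_lty.
  (* [e] is the mean of w over a slice. Subtracting it makes every slice integral zero, so e|X|
     equals the integral of w over X, which is 0; as |X| > 0 this yields C = 0 without measuring
     [Yi]. *)
  pose e := V^-1 * C.
  have ie := integrableZl measurableT e i1.
  have : \int[mu]_x (\1_X x * w x - e * \1_X x) = 0.
    apply: (slice_integral0 c_gt0 disK).
      exact: (integrableB measurableT iw ie).
    apply: aeW => t.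
    rewrite (eq_Rintegral _ (g := fun z => \1_Yi t * (\1_Zi z * w' z - e * \1_Zi z))).
      rewrite RintegralZl//; last first.
        exact: (integrableB measurableT iw'
          (integrableZl measurableT e indic_slice_integrable)).
      rewrite RintegralB// ?RintegralZl//; try exact: indic_slice_integrable.
        rewrite Rintegral_slice -/C /e mulrAC mulVf ?mul1r ?subrr ?mulr0//.
        by rewrite gt_eqF// volume_slice_gt0.
      exact: (integrableZl measurableT e indic_slice_integrable).
    move=> z _; rewrite /= indic_slice !indicE.
    have [Yt|Yt] := pselect (Yi t); last by rewrite (memNset Yt) /=; ring.
    have [Zz|Zz] := pselect (Zi z); last by rewrite (memNset Zz) /=; ring.
    by rewrite (ww' t)//; ring.
  rewrite RintegralB// RintegralZl//.
  rewrite (_ : \int[mu]_x (\1_X x * w x) = 0); last first.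
    by rewrite -[RHS]w0; apply: eq_Rintegral => x _; rewrite mulr1.
  move=> /eqP; rewrite sub0r oppr_eq0 !mulf_eq0 invr_eq0.
  rewrite (gt_eqF volume_slice_gt0) (gt_eqF Rintegral_indic_gt0) orbF.
  by move=> /eqP.
apply: (slice_integral0 c_gt0 disK).
  exact: (integrable_inner w2 k2).
apply: aeW => t; rewrite -[RHS](mulr0 (k t)) -(mulr0 (\1_Yi t)) -C0 -slice.
by apply: eq_Rintegral => z _; rewrite /= prK.
Qed.

(** The slice of the preimage at t is empty unless t lies in [N]. This turns exceptional parameters
    t into an exceptional null set of points. *)
Lemma preimage_pr_null (N : set T) : measurable N -> leb N = 0%E ->
  mu (pr @^-1` N) = 0%E.
Proof.
move=> mN N0; have mprN := measurable_preimage mpr mN.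
have mF : measurable_fun setT (\1_(pr @^-1` N) : Rn R m.+1 -> R).
  exact: measurable_indic.
have [|G [mG G0 intG aeG]] := disK mF; first by move=> x; rewrite indicE.
move: intG; rewrite integral_indic// setIT => intG.
have : (\int[leb]_t G t = 0)%E.
  rewrite (ae_eq_integral (cst 0%E)) ?integral0//.
  have aeN : {ae leb, forall t : T, ~ N t}.
    by exists N; split => // t /= /contrapT.
  move: aeG aeN; apply: filterS2 => t [_ <-] Nt _.
  rewrite integral0_eq// => z _.
  by rewrite indicE memNset//= prK.
by rewrite intG => /eqP; rewrite mule_eq0 eqe gt_eqF//= => /eqP.
Qed.

(** Jensen's inequality on a slice, by expanding the integral of the nonnegative (u - e)^2 with e
    the mean. *)
Lemma mean_sqr_le u t : Yi t ->
  mu'.-integrable setT (EFin \o (fun z => \1_Zi z * u (K t z))) ->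
  mu'.-integrable setT (EFin \o (fun z => \1_Zi z * u (K t z) ^+ 2)) ->
  V * mean u t ^+ 2 <= \int[mu']_z (\1_Zi z * u (K t z) ^+ 2).
Proof.
move=> Yt i1 i2; set e := mean u t.
have iZ := integrableZl measurableT (e ^+ 2) indic_slice_integrable.
have i1' := integrableZl measurableT (2 * e) i1.
rewrite -subr_ge0.
rewrite (_ : _ - _ = \int[mu']_z (\1_Zi z * (u (K t z) - e) ^+ 2)).
  by apply: Rintegral_ge0 => z _; rewrite mulr_ge0// sqr_ge0.
rewrite [RHS](eq_Rintegral _ (g := fun z => \1_Zi z * u (K t z) ^+ 2 -
  (2 * e) * (\1_Zi z * u (K t z)) + e ^+ 2 * \1_Zi z)); last first.
  by move=> z _; ring.
rewrite RintegralD//; last exact: (integrableB measurableT i2 i1').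
rewrite RintegralB// (RintegralZl _ measurableT i1).
rewrite (RintegralZl _ measurableT indic_slice_integrable).
by rewrite Rintegral_slice mean_slice -/e; ring.
Qed.

Lemma mean_in_L2 u : in_L2 X u -> in_L2 X (mean u \o pr).
Proof.
move=> u2.
have iu := integrable_in_L2 u2.
have iu2 := integrable_sqr_in_L2 u2.
have m1 : measurable_fun setT (\1_X : Rn R m.+1 -> R) by exact: measurable_indic.
have [G [iG _ aeG]] := lebesgue_fubini c_gt0 disK iu.
have mG : measurable_fun (setT : set T) G.
  by apply/measurable_EFinP; exact: (measurable_int _ iG).
(* The mean agrees with a measurable function only for almost every t in [Yi]. The exceptional t
   pull back to a null set, and completeness makes the composite measurable on X. *)
have aeM : {ae leb, forall t : T, Yi t -> mean u t = V^-1 * G t}.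
  move: aeG; apply: filterS => t [_ <-] Yt.
  rewrite (eq_Rintegral _ (g := fun z => \1_Zi z * u (K t z))); last first.
    by move=> z _; rewrite indic_slice [\1_Yi t]indicE mem_set// mul1r.
  by rewrite mean_slice mulKf// gt_eqF// volume_slice_gt0.
pose p x := \1_X x * mean u (pr x).
have mp : measurable_fun setT p.
  pose q x := \1_X x * (V^-1 * G (pr x)).
  have mq : measurable_fun setT q.
    apply: measurable_funM; first exact: m1.
    apply: measurable_funM; first exact: measurable_cst.
    exact: (measurableT_comp mG mpr).
  have aepq : ae_eq mu setT (EFin \o q) (EFin \o p).
    have [N [mN N0 subN]] := aeM.
    exists (pr @^-1` N); split.
    - exact: measurable_preimage mpr mN.
    - exact: preimage_pr_null.
    - move=> x /= npq; apply: subN => /= H; apply: npq => _.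
      rewrite /p /q indicE; case: (boolP (x \in X)) => [/set_mem Xx|]; last first.
        by rewrite !mul0r.
      by rewrite H//; exact: Xpr.
  apply/measurable_EFinP; apply: (ae_measurable_fun _ aepq).
    exact: measure_is_complete_caratheodory.
  exact/measurable_EFinP.
have pE : (mean u \o pr) \_ X = p.
  by apply/funext => x; rewrite restrict_indicE.
rewrite /in_L2 pE; apply/Lfun2P; split => //.
have mp2 : measurable_fun setT (fun x => p x ^+ 2) by exact: measurable_funX.
have [|H [mH H0 intH aeH]] := disK mp2; first by move=> x; exact: sqr_ge0.
have [G2 [iG2 _ aeG2]] := lebesgue_fubini c_gt0 disK iu2.
(* Jensen bounds the slice integral of p^2 by that of u^2, which is integrable in t. *)
have HG2 : {ae leb, forall t : T, H t <= `|(G2 t)%:E|}%E.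
  move: (ae_slice_integrable iu); apply: filter_app.
  move: (ae_slice_integrable iu2); apply: filter_app.
  move: aeH aeG2; apply: filterS2 => t [_ <-] [_ <-] it2 it1.
  have [Yt|Yt] := pselect (Yi t); last first.
    have -> : (\int[mu']_z (p (K t z) ^+ 2)%:E = 0)%E.
      apply: integral0_eq => z _.
      by rewrite /p indic_slice [\1_Yi t]indicE memNset// !mul0r expr0n.
    exact: abse_ge0.
  apply: le_trans (lee_abs _).
  rewrite [X in (_ <= X%:E)%E](eq_Rintegral _
    (g := fun z => \1_Zi z * u (K t z) ^+ 2)); last first.
    by move=> z _; rewrite indic_slice [\1_Yi t]indicE mem_set// mul1r.
  apply: (@le_trans _ _ (V * mean u t ^+ 2)%:E); last first.
    by rewrite lee_fin; apply: mean_sqr_le => //; [exact: it1|exact: it2].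
  rewrite (eq_integral (fun z => (mean u t ^+ 2)%:E * (\1_Zi z)%:E)%E).
    rewrite (integralZl measurableT indic_slice_integrable) integral_slice.
    by rewrite -EFinM mulrC.
  move=> z _; rewrite /p indic_slice [\1_Yi t]indicE mem_set// prK -EFinM.
  by congr (_%:E); rewrite indicE; case: (_ \in _) => /=; ring.
apply/integrableP; split; first exact/measurable_EFinP.
rewrite (eq_integral (fun x => (p x ^+ 2)%:E)); last first.
  by move=> x _; rewrite /= ger0_norm// sqr_ge0.
have : (\int[leb]_t H t < +oo)%E.
  apply: (@le_lt_trans _ _ (\int[leb]_t `|(G2 t)%:E|)%E).
    apply: ae_ge0_le_integral => //.
    - by apply: measurableT_comp => //; exact: (measurable_int leb iG2).
    - by move: HG2; apply: filterS => t.
  by case/integrableP : iG2.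
rewrite intH => cF; rewrite ltey; apply/eqP => Foo.
by rewrite Foo gt0_muley ?lte_fin// ltxx in cF.
Qed.

End product_slices.

(** * Linear change of variables for complete Lebesgue measure *)

Section lebesgue_scale.
Variables (R : realType) (n : nat).
Local Notation T := (measurableTypeR R).
Local Notation mu := (@lebesgue R n).
Variables (phi psi : n.-tuple T -> n.-tuple T).
Hypotheses (mphi : measurable_fun setT phi) (mpsi : measurable_fun setT psi)
  (phiK : cancel phi psi) (psiK : cancel psi phi)
  (phiD : {morph phi : x y / tuple_add x y}).

(** Measurability for the completed sigma-algebra survives composition because phi pulls Borel null
    sets back to null sets. *)
Lemma lebesgue_ge0_comp_scale : exists2 c : R, 0 < c &
  forall F : Rn R n -> R, measurable_fun setT F -> (forall x, 0 <= F x) ->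
  measurable_fun setT ((F \o phi) : Rn R n -> R) /\
  (\int[mu]_x (F (phi x))%:E = c%:E * \int[mu]_x (F x)%:E)%E.
Proof.
have [c c0 scale] := lebesgueB_scale mphi mpsi phiK psiK phiD.
exists c; first exact: c0.
move=> F mF F0.
have [g [N [mg mN N0 Fg]]] := completed_measurable_fun_borel mF.
pose h x : \bar R := `|g x|%:E.
have mh : measurable_fun setT h.
  apply/measurable_EFinP.
  exact: (measurableT_comp (@normr_measurable R setT) mg).
have h0 x : (0 <= h x)%E by rewrite lee_fin.
have Fh x : ~ N x -> (F x)%:E = h x.
  by move=> Nx; rewrite /h -Fg// ger0_norm.
have Fphih x : ~ (phi @^-1` N) x -> (F (phi x))%:E = h (phi x) by exact: Fh.
have mN' : measurable (phi @^-1` N) := measurable_preimage mphi mN.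
have N0' : @lebesgueB R n (phi @^-1` N) = 0%E by rewrite scale// N0 mule0.
have mhphi : measurable_fun setT (h \o phi) := measurableT_comp mh mphi.
split.
  apply/measurable_EFinP.
  exact: (@completed_ae_measurable _ _ R (@lebesgueB R n) _ _ _ mhphi mN' N0' Fphih).
transitivity (\int[@lebesgueB R n]_x h (phi x))%E.
  apply: (@ge0_integral_completed _ _ R (@lebesgueB R n) _ _ _ mhphi mN' N0' Fphih).
    by move=> x; rewrite lee_fin.
  by move=> x; exact: h0.
rewrite (@ge0_integral_comp_scale _ _ _ _ R phi (@lebesgueB R n)
    (@lebesgueB R n) c h mphi (ltW c0) scale mh h0); congr (_ * _)%E.
apply/esym.
apply: (@ge0_integral_completed _ _ R (@lebesgueB R n) _ _ _ mh mN N0 Fh _ h0).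
by move=> x; rewrite lee_fin.
Qed.

Lemma lebesgue_comp_scale : exists2 c : R, 0 < c &
  forall F : Rn R n -> R, mu.-integrable setT (EFin \o F) ->
  mu.-integrable setT (EFin \o (F \o phi)) /\
  \int[mu]_x F (phi x) = c * \int[mu]_x F x.
Proof.
have [c c0 scale] := lebesgue_ge0_comp_scale.
exists c; first exact: c0.
move=> F iF.
have half (H : Rn R n -> R) : (forall x, 0 <= H x) ->
    mu.-integrable setT (EFin \o H) ->
    mu.-integrable setT (EFin \o (H \o phi)) /\
    \int[mu]_x H (phi x) = c * \int[mu]_x H x.
  move=> H0 iH.
  have mH : measurable_fun setT H by exact/measurable_EFinP/(measurable_int mu iH).
  have [mHphi intH] := scale H mH H0.
  have fH := integrable_fin_num measurableT iH.
  split; last by rewrite /Rintegral intH fineM.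
  apply/integrableP; split; first exact/measurable_EFinP.
  rewrite (eq_integral (fun x : Rn R n => (H (phi x))%:E)); last first.
    by move=> x _; rewrite /= ger0_norm.
  by rewrite intH ltey_eq fin_numM.
have iFp := integrable_funrpos measurableT iF.
have iFn := integrable_funrneg measurableT iF.
have [ip ep] := half _ (funrpos_ge0 F) iFp.
have [ine en] := half _ (funrneg_ge0 F) iFn.
have FE x : F x = F^\+ x - F^\- x by rewrite -[in LHS](funrposBneg F).
split.
  apply: eq_integrable (integrableB measurableT ip ine) => //.
  by move=> z _; rewrite /= FE.
rewrite (eq_Rintegral _ (g := fun x : Rn R n => F^\+ (phi x) - F^\- (phi x))); last first.
  by move=> x _; rewrite FE.
rewrite RintegralB// ep en -mulrBr -RintegralB//; congr (_ * _).
by apply: eq_Rintegral => x _; rewrite FE.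
Qed.

End lebesgue_scale.

(** * The coordinate map J and its inverse *)

Section linear_coordinates.
Variables (R : realType) (n : nat).
Local Notation T := (measurableTypeR R).
Implicit Types (x y : n.-tuple T) (B : 'M[R]_n).

Lemma dotD (a : 'rV[R]_n) x y : dot a (tuple_add x y) = dot a x + dot a y.
Proof.
by rewrite /dot -big_split; apply: eq_bigr => j _; rewrite tnth_mktuple mulrDr.
Qed.

Lemma measurable_dot (a : 'rV[R]_n) :
  measurable_fun setT (dot a : n.-tuple T -> T).
Proof.
apply: measurable_sum => j; apply: measurable_funM => //.
exact: measurable_tnth.
Qed.

Lemma JmapD B : {morph Jmap B : x y / tuple_add x y}.
Proof.
by move=> x y; apply: eq_from_tnth => i; rewrite !tnth_mktuple dotD.
Qed.

Lemma measurable_Jmap B :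
  measurable_fun setT (Jmap B : n.-tuple T -> n.-tuple T).
Proof.
apply/measurable_fun_tnthP => i.
rewrite (_ : _ \o _ = dot (row i B)); first exact: measurable_dot.
by apply/funext => x /=; rewrite tnth_mktuple.
Qed.

Lemma dot_Jmap (a : 'rV[R]_n) B x : dot a (Jmap B x) = dot (a *m B) x.
Proof.
rewrite /dot; under eq_bigr do rewrite tnth_mktuple mulr_sumr.
rewrite exchange_big; apply: eq_bigr => j _ /=.
by rewrite mxE mulr_suml; apply: eq_bigr => k _; rewrite mxE mulrA.
Qed.

Lemma Jmap_mul B C x : Jmap B (Jmap C x) = Jmap (B *m C) x.
Proof.
by apply: eq_from_tnth => i; rewrite !tnth_mktuple dot_Jmap row_mul.
Qed.

Lemma Jmap1 x : Jmap 1%:M x = x.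
Proof.
apply: eq_from_tnth => i; rewrite tnth_mktuple /dot (bigD1 i)//=.
rewrite !mxE eqxx mul1r big1 ?addr0// => j ji.
by rewrite !mxE eq_sym (negbTE ji) mul0r.
Qed.

Lemma JmapK B : row_free B -> cancel (Jmap B) (Jinv B).
Proof.
by rewrite row_free_unit => Bu x; rewrite /Jinv Jmap_mul mulVmx// Jmap1.
Qed.

Lemma JinvK B : row_free B -> cancel (Jinv B) (Jmap B).
Proof.
by rewrite row_free_unit => Bu x; rewrite /Jinv Jmap_mul mulmxV// Jmap1.
Qed.

End linear_coordinates.

(** * Slices at a fixed coordinate y_i *)

Section coordinate_slices.
Variables (R : realType) (m : nat) (i : 'I_m.+1).
Local Notation T := (measurableTypeR R).

Lemma insert_coordE (t : R) (z : Rn R m) : tnth (insert_coord i t z) i = t.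
Proof. by rewrite tnth_mktuple unlift_none. Qed.

Lemma insert_coord_lift (t : R) (z : Rn R m) k :
  tnth (insert_coord i t z) (lift i k) = tnth z k.
Proof. by rewrite tnth_mktuple liftK. Qed.

Lemma insert_coord_neq (t t' : R) (z : Rn R m) j : j != i ->
  tnth (insert_coord i t z) j = tnth (insert_coord i t' z) j.
Proof.
rewrite eq_sym => /unlift_some[k -> _].
by rewrite !insert_coord_lift.
Qed.

Lemma slice_disintegrates (b : 'M[R]_m.+1) : row_free b ->
  exists2 c : R, 0 < c &
    disintegrates c (fun t z => Jinv b (insert_coord i t z)).
Proof.
move=> hb.
(* [ins] moves the first coordinate to position i and [del] moves it back. Composed with J^-1 and J
   they turn slices at y_i = t into slices at first coordinate t. *)
pose ins (y : m.+1.-tuple T) : m.+1.-tuple T :=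
  insert_coord i (tnth y ord0) [tuple of behead y].
pose del (y : m.+1.-tuple T) : m.+1.-tuple T :=
  cons_pair (tnth y i, [tuple tnth y (lift i k) | k < m] : m.-tuple T).
have tnth_behead_lift (y : m.+1.-tuple T) k :
    tnth [tuple of behead y] k = tnth y (lift ord0 k).
  by rewrite !(tnth_nth 0) /= nth_behead.
have insK : cancel ins del.
  move=> y; apply: eq_from_tnth => j.
  case: (unliftP ord0 j) => [k|] ->.
    by rewrite tnthS tnth_mktuple insert_coord_lift tnth_behead_lift.
  by rewrite tnth0 insert_coordE.
have delK : cancel del ins.
  move=> y; apply: eq_from_tnth => j; rewrite /ins.
  case: (unliftP i j) => [k|] ->.
    by rewrite insert_coord_lift tnth_behead_lift tnthS tnth_mktuple.
  by rewrite insert_coordE tnth0.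
have mins : measurable_fun setT ins.
  apply/measurable_fun_tnthP => j; case: (unliftP i j) => [k|] ->.
    rewrite (_ : _ \o _ = fun y => tnth y (lift ord0 k)); last first.
      by apply/funext => y /=; rewrite insert_coord_lift tnth_behead_lift.
    exact: measurable_tnth.
  rewrite (_ : _ \o _ = fun y => tnth y ord0); last first.
    by apply/funext => y /=; rewrite insert_coordE.
  exact: measurable_tnth.
have mdel : measurable_fun setT del.
  apply/measurable_fun_tnthP => j; case: (unliftP ord0 j) => [k|] ->.
    rewrite (_ : _ \o _ = fun y => tnth y (lift i k)); last first.
      by apply/funext => y /=; rewrite tnthS tnth_mktuple.
    exact: measurable_tnth.
  rewrite (_ : _ \o _ = fun y => tnth y i); last first.
    by apply/funext => y /=; rewrite tnth0.
  exact: measurable_tnth.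
have insD : {morph ins : x y / tuple_add x y}.
  move=> x y; apply: eq_from_tnth => j; rewrite [RHS]tnth_mktuple /ins.
  case: (unliftP i j) => [k|] ->.
    by rewrite !insert_coord_lift !tnth_behead_lift tnth_mktuple.
  by rewrite !insert_coordE tnth_mktuple.
have [c c0 dis] := @lebesgue_tonelli R m (Jinv b \o ins) (del \o Jmap b)
  (measurableT_comp (measurable_Jmap (invmx b)) mins)
  (measurableT_comp mdel (measurable_Jmap b))
  (fun y => etrans (congr1 del (JinvK hb _)) (insK y))
  (fun y => etrans (congr1 (Jinv b) (delK _)) (JmapK hb y))
  (fun x y => etrans (congr1 (Jinv b) (insD x y)) (JmapD (invmx b) _ _)).
exists c => //; rewrite (_ : (fun t z => _) = fun t z =>
  (Jinv b \o ins) (cons_pair (t, z)))//.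
apply/funext => t; apply/funext => z /=; rewrite /ins tnth0.
by congr (Jinv b (insert_coord i t _)); exact/val_inj.
Qed.

End coordinate_slices.

(** * Orthogonality of the residual *)

Section best_approximation.
Variables (R : realType) (m r : nat) (hrn : (r <= m.+1)%N).
Local Notation T := (measurableTypeR R).
Local Notation n := m.+1.
Local Notation mu := (@lebesgue R n).
Variables (b : 'M[R]_n) (X : set (Rn R n)) (f : Rn R n -> R).
Variable Y0 : set (Rn R (n - r)).
Hypotheses (hb : row_free b) (mX : measurable X).
Hypotheses (X_gt0 : (0 < lebesgue X)%E) (X_lty : (lebesgue X < +oo)%E).
Hypotheses (f2 : in_L2 X f) (hY : Yimg X b = rset hrn (Yproj hrn X b) Y0).

Let co (i : 'I_r) : 'I_n := widen_ord hrn i.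
Let pr (i : 'I_r) : Rn R n -> T := dot (row (co i) b).
Let K (i : 'I_r) (t : T) (z : Rn R m) : Rn R n :=
  Jinv b (insert_coord (co i) t z).

Let co_neq i j : j != i -> co j != co i.
Proof. by apply: contraNN => /eqP/(congr1 val)/= ji; exact/eqP/val_inj. Qed.

Lemma Yimg_Jinv y : Yimg X b y <-> X (Jinv b y).
Proof.
split=> [[x Xx <-]|Xy]; first by rewrite JmapK.
by exists (Jinv b y) => //; rewrite JinvK.
Qed.

Lemma dot_Jinv i y : pr i (Jinv b y) = tnth y (co i).
Proof. by rewrite -[in RHS](JinvK hb y) tnth_mktuple. Qed.

Lemma coordinate_slice i t z : pr i (K i t z) = t.
Proof. by rewrite dot_Jinv insert_coordE. Qed.

(** Position i lies among the first r coordinates, which are dropped; hence the placeholder 0 in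
    [rset_omit] may be exchanged for any t. *)
Lemma drop_insert_coord i (t t' : R) (z : Rn R m) :
  drop_tuple r (insert_coord (co i) t z) = drop_tuple r (insert_coord (co i) t' z).
Proof.
apply: eq_from_tnth => k.
have lt_rk : (r + k < n)%N by have := ltn_ord k; rewrite ltn_subRL.
have E (y : Rn R n) : tnth (drop_tuple r y) k = tnth y (Ordinal lt_rk).
  by rewrite !(tnth_nth 0) /= nth_drop.
rewrite !E; apply: insert_coord_neq.
apply/eqP => /(congr1 val) /= ri.
by have := ltn_ord i; rewrite -ri ltnNge leq_addr.
Qed.

Lemma X_slice i t z :
  X (K i t z) <-> Yproj hrn X b i t /\ Yomit hrn X b Y0 i z.
Proof.
rewrite -Yimg_Jinv hY /rset /Yomit /rset_omit /= (drop_insert_coord i t 0).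
split=> [[H1 H2]|[Ht [H1 H2]]].
  split; first by have := H1 i; rewrite insert_coordE.
  split=> [j ji|]; last exact: H2.
  by rewrite -(insert_coord_neq t 0 z (co_neq ji)); exact: H1.
split=> // j; have [->|ji] := eqVneq j i; first by rewrite insert_coordE.
by rewrite (insert_coord_neq t 0 z (co_neq ji)); exact: H1.
Qed.

Lemma X_proj i x : X x -> Yproj hrn X b i (pr i x).
Proof. by move=> Xx; exists x. Qed.

Lemma measurable_proj i : measurable_fun setT (pr i).
Proof.
apply: (@measurable_fun_completed _ _ R (@lebesgueB R n)).
exact: measurable_dot.
Qed.

Let mean (i : 'I_r) (t : R) : R :=
  (vol (Yomit hrn X b Y0 i))^-1 * fistar hrn X b Y0 f i t.

Let e : R := Aint X b f / vol (Yimg X b).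

Lemma coordinate_mean_in_L2 i : in_L2 X (mean i \o pr i).
Proof.
have [c c0 dis] := slice_disintegrates (co i) hb.
exact: (mean_in_L2 c0 dis mX X_gt0 X_lty (X_slice i) (X_proj i)
  (measurable_proj i) (coordinate_slice i) f2).
Qed.

Lemma inner_coordinate_mean i k : in_L2 X (k \o pr i) ->
  inner X (fun x => f x - mean i (pr i x)) (k \o pr i) = 0.
Proof.
move=> k2; have [c c0 dis] := slice_disintegrates (co i) hb.
exact: (inner_mean c0 dis mX X_gt0 X_lty (X_slice i) (coordinate_slice i)
  f2 (coordinate_mean_in_L2 i) k2).
Qed.

(** A and |Y| are the integrals over X of f and of 1, both multiplied by the same
    change-of-variables factor, so A/|Y| is the mean of f over X. *)
Lemma mean_value : inner X f (fun=> 1) = inner X (fun=> e) (fun=> 1).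
Proof.
have [c c0 scale] := lebesgue_comp_scale (measurable_Jmap (invmx b))
  (measurable_Jmap b) (JinvK hb) (JmapK hb) (JmapD (invmx b)).
have i1 := integrable_indic_lty mX X_lty.
have ifX := integrable_in_L2 mX X_lty f2.
have [iY eY] := scale _ i1.
have [_ eA] := scale _ ifX.
have indicY y : \1_(Yimg X b) y = \1_X (Jinv b y) :> R.
  rewrite !indicE; have [Yy|nYy] := pselect (Yimg X b y).
    by rewrite !mem_set//; exact/Yimg_Jinv.
  by rewrite !memNset//; apply: contra_not nYy => /Yimg_Jinv.
(* The indicator of Y is that of X composed with J^-1, hence measurable; this lets [vol] be computed
   as the integral of the indicator. *)
have mY : measurable (Yimg X b).
  have mf : measurable_fun (setT : set (Rn R n)) ((\1_X : Rn R n -> R) \o Jinv b).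
    by apply/measurable_EFinP; exact: (measurable_int _ iY).
  have := measurable_preimage mf (measurable_set1 1).
  rewrite (_ : _ @^-1` _ = Yimg X b)//.
  apply/seteqP; split=> y /=; rewrite -indicY indicE.
    by case: (boolP (y \in _)) => [/set_mem//|_ /eqP]; rewrite eq_sym oner_eq0.
  by move=> Yy; rewrite mem_set.
have AE : Aint X b f = c * \int[mu]_x (\1_X x * f x).
  rewrite -eA /Aint Rintegral_mkcond; apply: eq_Rintegral => y _.
  by rewrite restrict_indicE indicY.
have YE : vol (Yimg X b) = c * \int[mu]_x \1_X x.
  rewrite -eY /vol /Rintegral; congr fine.
  rewrite (eq_integral (fun y => (\1_(Yimg X b) y)%:E)).
    by rewrite integral_indic// setIT.
  by move=> y _; rewrite indicY.
have X0 := Rintegral_indic_gt0 mX X_gt0 X_lty.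
transitivity (\int[mu]_x (\1_X x * f x)).
  by apply: eq_Rintegral => x _; rewrite mulr1.
transitivity (e * \int[mu]_x \1_X x).
  rewrite /e AE YE invfM mulrACA divff ?gt_eqF// mul1r.
  by rewrite mulfVK// gt_eqF.
rewrite -RintegralZl//; apply: eq_Rintegral => x _; ring.
Qed.

Lemma inner_other_coordinate i j k : j != i -> in_L2 X (k \o pr i) ->
  inner X (fun x => mean j (pr j x) - e) (k \o pr i) = 0.
Proof.
move=> ji k2; have [c c0 dis] := slice_disintegrates (co i) hb.
have p2 := coordinate_mean_in_L2 j.
have e2 := in_L2_cst mX X_lty e; have o2 := in_L2_cst mX X_lty 1.
(* Since j differs from i, y_j is the same whatever value is inserted at position i; 0 is an
   arbitrary choice. *)
apply: (inner_cross c0 dis mX X_gt0 X_lty (X_slice i) (coordinate_slice i)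
  (w' := fun z => mean j (tnth (insert_coord (co i) 0 z) (co j)) - e)) => //.
- exact: in_L2B.
- by move=> t z _ _; rewrite dot_Jinv (insert_coord_neq t 0 _ (co_neq ji)).
(* Orthogonality of f - p_j to the constants gives p_j the same integral over X as f. *)
- rewrite innerBl// -mean_value.
  have := inner_coordinate_mean (i := j) (k := fun=> 1) o2.
  by rewrite innerBl// => /eqP; rewrite subr_eq0 => /eqP ->; rewrite subrr.
Qed.

Let h (x : Rn R n) : R := \sum_(i < r) g0 hrn X b Y0 f i (pr i x).

(** The correction (r - 1) A/|Y|, placed in the first summand only, consists of as many copies of
    A/|Y| as there are indices j != i. Spreading it over them removes the special role of the first
    direction. *)
Lemma sum_g0E i x :
  h x = mean i (pr i x) + \sum_(j < r | j != i) (mean j (pr j x) - e).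
Proof.
have r0 : (0 < r)%N by exact: leq_ltn_trans (ltn_ord i).
pose i0 := Ordinal r0.
have g0E j t : g0 hrn X b Y0 f j t =
    mean j t - (if j == i0 then (r%:R - 1) * e else 0).
  rewrite /g0 -(inj_eq val_inj) /=; case: ifP => _; rewrite ?subr0//.
rewrite /h (eq_bigr _ (fun j _ => g0E j _)) sumrB -big_mkcond big_pred1_eq.
rewrite sumrB (bigD1 i)//= -addrA; congr (_ + (_ - _)).
rewrite sumr_const -[RHS]mulr_natl; congr (_ * _).
rewrite (_ : #|_| = (r - 1)%N) ?natrB//.
by rewrite -[r in RHS]card_ord -(cardC (pred1 i)) card1 addKn.
Qed.

Lemma best_in_ridge_space i : in_L2 X (fun x => g0 hrn X b Y0 f i (pr i x)).
Proof.
have p2 := coordinate_mean_in_L2 i.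
rewrite /g0; case: (i == 0%N :> nat); last exact: p2.
exact: (in_L2B p2 (in_L2_cst mX X_lty ((r%:R - 1) * e))).
Qed.

Lemma inner_residual i k : in_L2 X (k \o pr i) ->
  inner X (fun x => f x - h x) (k \o pr i) = 0.
Proof.
move=> k2.
have p2 := coordinate_mean_in_L2; have e2 := in_L2_cst mX X_lty e.
have pe2 j : in_L2 X (fun x => mean j (pr j x) - e) := in_L2B (p2 j) e2.
rewrite (_ : (fun x => _) = (fun x => (f x - mean i (pr i x)) -
    \sum_(j < r | j != i) (mean j (pr j x) - e))); last first.
  by apply/funext => x; rewrite (sum_g0E i) opprD addrA.
rewrite innerBl//; last 2 first.
- exact: in_L2B (p2 i).
- exact: in_L2_sum.
rewrite inner_coordinate_mean// inner_suml// big1 ?subrr// => j ji.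
exact: inner_other_coordinate.
Qed.

Lemma ridge_best_approximation (g : 'I_r -> R -> R) :
  (forall i, in_L2 X (fun x => g i (pr i x))) ->
  (L2norm X (fun x => f x - h x)%R <=
   L2norm X (fun x => f x - \sum_(i < r) g i (pr i x))%R)%E.
Proof.
move=> g2.
have h2 := best_in_ridge_space.
(* The difference between [h] and a competitor is again a ridge sum in the same directions, so the
   residual is tested against it one direction at a time. *)
have d2 i : in_L2 X ((fun t => g0 hrn X b Y0 f i t - g i t) \o pr i).
  exact: in_L2B (h2 i) (g2 i).
have fh2 : in_L2 X (fun x => f x - h x).
  by apply: in_L2B => //; exact: in_L2_sum.
rewrite (_ : (fun x => f x - \sum_(i < r) g i (pr i x)) = (fun x => (f x - h x) +
    \sum_(i < r) (g0 hrn X b Y0 f i (pr i x) - g i (pr i x)))); last first.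
  by apply/funext => x; rewrite sumrB -/(h x) addrA subrK.
apply: L2norm_le_orthogonal => //; first exact: in_L2_sum.
rewrite innerC; apply: (etrans (inner_suml mX X_lty _ _ d2 fh2)).
by rewrite big1// => i _; rewrite innerC; exact: (inner_residual (d2 i)).
Qed.

End best_approximation.

Theorem theorem1p13 (R : realType) (n r : nat) (hr : (0 < r)%N)
  (hrn : (r <= n)%N)
  (a : 'M[R]_(r, n)) (ha : row_free a)
  (b : 'M[R]_n) (hb : row_free b)
  (hab : forall i : 'I_r, row (widen_ord hrn i) b = row i a)
  (X : set (Rn R n)) (mX : measurable X)
  (X_gt0 : (0 < lebesgue X)%E) (X_lty : (lebesgue X < +oo)%E)
  (f : Rn R n -> R) (hf : in_L2 X f)
  (Y0 : set (Rn R (n - r)))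
  (hY : Yimg X b = rset hrn (Yproj hrn X b) Y0) :
  let h := fun x : Rn R n => \sum_(i < r) g0 hrn X b Y0 f i (dot (row i a) x) in
  ridge_space X a h /\
  L2norm X (f \- h) = ereal_inf [set L2norm X (f \- g) | g in ridge_space X a].
Proof.
(* Slices live in dimension n - 1, so n has to be a successor; n = 0 contradicts 0 < r <= n. *)
move=> h; case: n hrn a ha b hb hab X mX X_gt0 X_lty f hf Y0 hY @h
  => [|m] hrn a ha b hb hab X mX X_gt0 X_lty f hf Y0 hY h.
  by exfalso; move: (leq_trans hr hrn).
have h_ridge : ridge_space X a h.
  exists (g0 hrn X b Y0 f); split=> // i.
  rewrite -hab; exact: (best_in_ridge_space hb mX X_gt0 X_lty hf hY).
have hE : h = fun x => \sum_(i < r) g0 hrn X b Y0 f i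
    (dot (row (widen_ord hrn i) b) x).
  by apply/funext => x; apply: eq_bigr => i _; rewrite hab.
split=> //; apply/eqP; rewrite eq_le; apply/andP; split; last first.
  by apply: ereal_inf_lbound; exists h.
apply: le_ereal_inf_tmp => _ [_ [g [g2 ->]] <-].
have {}g2 i : in_L2 X (fun x => g i (dot (row (widen_ord hrn i) b) x)).
  by rewrite hab.
have := ridge_best_approximation hb mX X_gt0 X_lty hf hY g2.
rewrite hE; congr (_ <= L2norm X _)%E; apply/funext => x /=.
by congr (_ - _); apply: eq_bigr => i _; rewrite hab.
Qed.
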